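(* Assume the setting below, and suppose the reduced solution $u_0$ is a linear function. On the A-mesh $S_{1/\varepsilon}$ (i.e. $\lambda=\varepsilon^{-1}$) with mesh parameter $a\ge4$, let $U^N$ be the solution of $U^N_0=0$, $L^NU^N_i=f(x_i)$ for $1\le i\le N-1$, $U^N_N=0$. There exist $N_0$ and $C$, both independent of $\varepsilon$, such that for all $N\ge N_0$, \[ \|u^N-U^N\|\le C\max\left\{\varepsilon|\ln\varepsilon|^3N^{-2},\ \varepsilon N^{-2}+\varepsilon^2N^{-1}\right\}. \]
   Context: Let $0<\varepsilon<1$. Let $b,c,f\in C^4[0,1]$, and let $\beta$ be a constant with $b(x)>\beta>0$ and $c(x)\ge0$ on $[0,1]$. Let $u$ be the solution of $-\varepsilon u''-bu'+cu=f$ on $(0,1)$ with $u(0)=u(1)=0$. The reduced solution $u_0$ is the solution of $-bu_0'+cu_0=f$ on $(0,1)$ with $u_0(1)=0$. Mesh $S_\lambda$, $\lambda\in\{N,\varepsilon^{-1}\}$. $N$ is a positive integer. $Q\in(0,1)$ is a fixed rational with $J=QN$ an integer, and $a>0$. Set $\xi=(a\varepsilon/\beta)\ln\lambda$, assumed $\le Q$, and $h=\xi/J$, $H=(1-\xi)/(N-J)$. The mesh points are $x_i=ih$ ($0\le i\le J$) and $x_i=\xi+(i-J)H$ ($J\le i\le N$). Write $h_i=x_i-x_{i-1}$ and $\hbar_i=(h_i+h_{i+1})/2$. Scheme. $D^+U_i=(U_{i+1}-U_i)/h_{i+1}$, $D^-U_i=(U_i-U_{i-1})/h_i$, $D''U_i=(D^+U_i-D^-U_i)/\hbar_i$.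 Let $\sigma(\rho)=2\rho/(e^{2\rho}-1)$ for $\rho>0$, $\sigma(0)=1$, and $\rho_i=b(x_i)h_{i+1}/(2\varepsilon)$. The ASI operator is $L^NU_i=-\varepsilon\sigma(\rho_i)D''U_i-b(x_i)D^+U_i+c(x_i)U_i$. $u^N$ is the restriction of $u$ to the mesh, and $\|U\|=\max_i|U_i|$. *)

(* Defs.v *)
From Stdlib Require Import Reals Lra Lia ZArith.
From Coquelicot Require Import Coquelicot.
Open Scope R_scope.

(* g belongs to C^4[0,1]: g agrees on [0,1] with a C^4 function on R
   (equivalent to the usual one-sided-derivative definition). *)
Definition C4_01 (g : R -> R) : Prop :=
  exists G : R -> R,
    (forall x, 0 <= x <= 1 -> G x = g x) /\
    (forall (k : nat) (x : R), (k <= 4)%nat -> ex_derive_n G k x) /\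
    (forall x, continuous (Derive_n G 4) x).

Definition cont_01 (u : R -> R) : Prop :=
  forall x, 0 <= x <= 1 ->
    filterlim u (within (fun y => 0 <= y <= 1) (locally x)) (locally (u x)).

Definition is_solution (eps : R) (b c f u : R -> R) : Prop :=
  cont_01 u /\
  (forall x, 0 < x < 1 ->
     ex_derive u x /\ ex_derive (Derive u) x /\
     - eps * Derive (Derive u) x - b x * Derive u x + c x * u x = f x) /\
  u 0 = 0 /\ u 1 = 0.

Definition is_reduced_solution (b c f u0 : R -> R) : Prop :=
  cont_01 u0 /\
  (forall x, 0 < x < 1 ->
     ex_derive u0 x /\ - b x * Derive u0 x + c x * u0 x = f x) /\
  u0 1 = 0.

Definition is_linear_01 (u0 : R -> R) : Prop :=
  exists alpha gamma : R, forall x, 0 <= x <= 1 -> u0 x = alpha * x + gamma.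

Definition is_rational (q : R) : Prop :=
  exists (p : Z) (d : positive), q = IZR p / IZR (Zpos d).

Definition xi_tr (eps beta a lambda : R) : R := a * eps / beta * ln lambda.

Definition meshpt (eps beta a lambda : R) (N J : nat) (i : nat) : R :=
  let xi := xi_tr eps beta a lambda in
  if (i <=? J)%nat then INR i * (xi / INR J)
  else xi + INR (i - J) * ((1 - xi) / INR (N - J)).

Definition hstep (x : nat -> R) (i : nat) : R := x i - x (i - 1)%nat.
Definition hbar (x : nat -> R) (i : nat) : R := (hstep x i + hstep x (S i)) / 2.
Definition Dplus (x : nat -> R) (U : nat -> R) (i : nat) : R :=
  (U (S i) - U i) / hstep x (S i).
Definition Dminus (x : nat -> R) (U : nat -> R) (i : nat) : R :=
  (U i - U (i - 1)%nat) / hstep x i.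
Definition D2 (x : nat -> R) (U : nat -> R) (i : nat) : R :=
  (Dplus x U i - Dminus x U i) / hbar x i.

Definition sigma (rho : R) : R :=
  if Req_EM_T rho 0 then 1 else 2 * rho / (exp (2 * rho) - 1).

Definition rho_i (eps : R) (b : R -> R) (x : nat -> R) (i : nat) : R :=
  b (x i) * hstep x (S i) / (2 * eps).

Definition LN (eps : R) (b c : R -> R) (x : nat -> R) (U : nat -> R) (i : nat) : R :=
  - eps * sigma (rho_i eps b x i) * D2 x U i - b (x i) * Dplus x U i + c (x i) * U i.

Definition is_discrete_solution (eps : R) (b c f : R -> R) (x : nat -> R)
    (N : nat) (U : nat -> R) : Prop :=
  U 0%nat = 0 /\ U N = 0 /\
  (forall i, (1 <= i <= N - 1)%nat -> LN eps b c x U i = f (x i)).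

(* Main.v *)
(* Since [u0] is linear, both the differential operator and the scheme act on it
   exactly, so [w = u - u0] and its discrete counterpart solve the homogeneous
   problems with the same boundary data and only the boundary layer is left to
   approximate.  It obeys [|w^(j)| <= C eps^(-j) exp (- beta x / eps)], [j <= 2].

   The fitted stencil on a uniform mesh is exact on [1], [x] and
   [exp (- b(x_i) x / eps)]; hence it is a positive average of
   [- eps w'' - b(x_i) w' = (b - b(x_i)) w' - c w], and the truncation error is
   [O ((h / eps)^2)] times the layer function, using [w'] and [w''] only.  At the
   transition point it is [O (H / eps^2)] times the layer function, which there
   is about [eps^a <= eps^4].

   The discrete maximum principle is applied with the barrier
   [K1 * prod_(j <= i) (1 + beta h_j / (2 eps))^-1 + K2 * (2 - x_i)].  The first
   term absorbs the fine part of the mesh, where [h / eps] is proportional to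
   [|ln eps| / N], so that [K1] is of order [(h / eps)^2 (eps + h)]; the second
   absorbs the transition point and the coarse part. *)
Require Import Defs.
From Stdlib Require Import Reals Lra Lia.
From Coquelicot Require Import Coquelicot.
Open Scope R_scope.

(** * Mean value and Rolle-type tools on the real line *)

Lemma mean_value (f df : R -> R) (p q : R) :
  p < q ->
  (forall y, p < y < q -> is_derive f y (df y)) ->
  (forall y, p <= y <= q -> continuity_pt f y) ->
  exists y, p < y < q /\ f q - f p = df y * (q - p).
Proof.
intros Hpq Hd Hc.
assert (pr : forall y, p < y < q -> derivable_pt f y).
{ intros y Hy; exists (df y); apply is_derive_Reals; auto. }
destruct (MVT f id p q pr (fun y _ => derivable_pt_id y) Hpq Hc) as [y [P HP]].
{ intros y _; apply derivable_continuous_pt, derivable_pt_id. }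
exists y; split; [exact P|].
rewrite derive_pt_id in HP; unfold id in HP.
rewrite Derive_Reals, (is_derive_unique _ _ _ (Hd y P)) in HP; lra.
Qed.

Lemma is_derive_continuity (f : R -> R) (x l : R) :
  is_derive f x l -> continuity_pt f x.
Proof.
intros H; apply derivable_continuous_pt; exists l; now apply is_derive_Reals.
Qed.

(** The bound on [df] is asked only strictly between [x] and [y], in either order: the layer grows
    to the left, so later bounds hold on such an interval and not on all of [(p, q)]. *)
Lemma derive_bound_lipschitz (f df : R -> R) (K p q x y : R) :
  p < x < q -> p < y < q ->
  (forall t, p < t < q -> is_derive f t (df t)) ->
  (forall t, p < t < q -> x < t < y \/ y < t < x -> Rabs (df t) <= K) ->
  Rabs (f y - f x) <= K * Rabs (y - x).
Proof.
intros Hx Hy Hd Hb.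
assert (wl : forall u v, p < u -> u < v -> v < q ->
             (forall t, u < t < v -> Rabs (df t) <= K) ->
             Rabs (f v - f u) <= K * Rabs (v - u)).
{ intros u v Hu Huv Hv HK.
  destruct (mean_value f df u v Huv) as [t [Ht ->]].
  - intros t Ht; apply Hd; lra.
  - intros t Ht; eapply is_derive_continuity, Hd; lra.
  - rewrite Rabs_mult; apply Rmult_le_compat_r; [apply Rabs_pos|apply HK; lra]. }
destruct (Rtotal_order x y) as [H|[->|H]].
- apply wl; try lra; intros; apply Hb; lra.
- rewrite !Rminus_diag, Rabs_R0; lra.
- rewrite Rabs_minus_sym, (Rabs_minus_sym y).
  apply wl; try lra; intros; apply Hb; lra.
Qed.

(* Rolle applied to [g], then to [g1 * exp (k .)]. *)
Lemma three_zeros (g g1 g2 : R -> R) (k p x q : R) :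
  p < x < q ->
  (forall y, p < y < q -> is_derive g y (g1 y) /\ is_derive g1 y (g2 y)) ->
  (forall y, p <= y <= q -> continuity_pt g y) ->
  g p = 0 -> g x = 0 -> g q = 0 ->
  exists y, p < y < q /\ g2 y + k * g1 y = 0.
Proof.
intros Hx Hd Hc Zp Zx Zq.
destruct (mean_value g g1 p x) as [s [Hs Es]]; try lra.
{ intros; apply Hd; lra. } { intros; apply Hc; lra. }
destruct (mean_value g g1 x q) as [t [Ht Et]]; try lra.
{ intros; apply Hd; lra. } { intros; apply Hc; lra. }
assert (Hs0 : g1 s = 0) by nra.
assert (Ht0 : g1 t = 0) by nra.
assert (D : forall y, p < y < q ->
  is_derive (fun y => g1 y * exp (k * y)) y ((g2 y + k * g1 y) * exp (k * y))).
{ intros y Hy; destruct (Hd y Hy) as [_ H2].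
  replace ((g2 y + k * g1 y) * exp (k * y))
    with (g2 y * exp (k * y) + g1 y * (k * exp (k * y))) by ring.
  apply (is_derive_mult g1 (fun y => exp (k * y)));
    [assumption| |intros; apply Rmult_comm].
  auto_derive; [trivial|ring]. }
destruct (mean_value (fun y => g1 y * exp (k * y))
  (fun y => (g2 y + k * g1 y) * exp (k * y)) s t) as [y [Hy Ey]]; try lra.
{ intros; apply D; lra. }
{ intros; eapply is_derive_continuity, D; lra. }
exists y; split; [lra|].
rewrite Hs0, Ht0 in Ey. pose proof (exp_pos (k * y)).
assert (E0 : (g2 y + k * g1 y) * (exp (k * y) * (t - s)) = 0) by lra.
apply Rmult_integral in E0; destruct E0 as [E0|E0]; [exact E0|].
assert (0 < exp (k * y) * (t - s)) by (apply Rmult_lt_0_compat; lra). lra.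
Qed.

(** * Continuous maximum principle and decay of the layer component *)

(** At a positive interior maximum the first derivative vanishes, so the strict inequality forces
    [v2 > 0]; then [v1 > 0] just to the right and [v] would still increase. *)
Lemma maximum_principle (eps : R) (b c v v1 v2 : R -> R) :
  0 < eps ->
  (forall x, 0 < x < 1 -> 0 <= c x) ->
  (forall x, 0 < x < 1 -> is_derive v x (v1 x) /\ is_derive v1 x (v2 x)) ->
  (forall x, 0 <= x <= 1 -> continuity_pt v x) ->
  v 0 <= 0 -> v 1 <= 0 ->
  (forall x, 0 < x < 1 -> - eps * v2 x - b x * v1 x + c x * v x < 0) ->
  forall x, 0 <= x <= 1 -> v x <= 0.
Proof.
intros He Hc Hd Hcont V0 V1 HL x Hx.
destruct (continuity_ab_maj v 0 1) as [m [Hm Im]]; [lra|assumption|].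
destruct (Rle_or_lt (v m) 0) as [|Pm]; [specialize (Hm x Hx); lra|].
assert (Om : 0 < m < 1).
{ destruct (Req_dec m 0); [subst; lra|]. destruct (Req_dec m 1); [subst; lra|]. lra. }
destruct (Hd m Om) as [D1 D2].
assert (Z : v1 m = 0).
{ assert (pr : derivable_pt v m) by (exists (v1 m); now apply is_derive_Reals).
  rewrite <- (is_derive_unique _ _ _ D1), <- (Derive_Reals _ _ pr).
  apply (deriv_maximum v 0 1 m pr); try lra.
  intros y H0 H1; apply Hm; lra. }
assert (P2 : 0 < v2 m).
{ specialize (HL m Om); specialize (Hc m Om). rewrite Z in HL. nra. }
apply is_derive_Reals in D2.
destruct (D2 (v2 m) P2) as [d Hdl].
pose proof (cond_pos d) as Dp.
(* [r] stays within [d] of [m] and below 1, so the mean value point in [(m, r)] falls where the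
   difference quotient of [v1] is positive. *)
set (r := Rmin (m + d / 2) ((m + 1) / 2)).
assert (Hr : m < r /\ r <= m + d / 2 /\ r < 1).
{ unfold r; repeat split.
  - apply Rmin_glb_lt; lra.
  - apply Rmin_l.
  - eapply Rle_lt_trans; [apply Rmin_r|lra]. }
destruct (mean_value v v1 m r) as [y [Hy Ey]]; try lra.
{ intros; apply Hd; lra. } { intros; apply Hcont; lra. }
assert (Py : 0 < v1 y).
{ assert (Hn : y - m <> 0) by lra.
  specialize (Hdl (y - m) Hn).
  rewrite (Rabs_right (y - m)) in Hdl by lra.
  assert (Hlt : y - m < d) by lra. specialize (Hdl Hlt).
  replace (m + (y - m)) with y in Hdl by ring.
  rewrite Z in Hdl. apply Rabs_def2 in Hdl.
  assert (0 < (v1 y - 0) / (y - m)) by lra.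
  replace (v1 y) with ((v1 y - 0) / (y - m) * (y - m)) by (field; lra).
  apply Rmult_lt_0_compat; lra. }
assert (v r <= v m) by (apply Hm; lra). nra.
Qed.

(** A single bound for the function and two derivatives lets later error constants be chosen before
    the coefficients themselves. *)
Definition C2_bounded (K : R) (g g1 g2 : R -> R) : Prop :=
  forall x, 0 < x < 1 ->
    is_derive g x (g1 x) /\ is_derive g1 x (g2 x) /\
    Rabs (g x) <= K /\ Rabs (g1 x) <= K /\ Rabs (g2 x) <= K.

(** Continuity at 0 and 1 is two-sided, so [w] stands for an extension of a solution from [[0,1]] to
    the line; the equation is asked inside only. *)
Definition homogeneous_solution (eps : R) (b c w w1 w2 : R -> R) : Prop :=
  (forall x, 0 <= x <= 1 -> continuity_pt w x) /\
  (forall x, 0 < x < 1 -> is_derive w x (w1 x) /\ is_derive w1 x (w2 x)) /\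
  (forall x, 0 < x < 1 -> - eps * w2 x - b x * w1 x + c x * w x = 0).

Definition layer (k x : R) : R := exp (- (k * x)).

Lemma layer_pos (k x : R) : 0 < layer k x.
Proof. apply exp_pos. Qed.

Lemma layer_0 (k : R) : layer k 0 = 1.
Proof. unfold layer; rewrite Rmult_0_r, Ropp_0; apply exp_0. Qed.

Lemma layer_plus (k x y : R) : layer k (x + y) = layer k x * layer k y.
Proof. unfold layer; rewrite <- exp_plus; f_equal; ring. Qed.

Lemma layer_antitone (k x y : R) : 0 < k -> x <= y -> layer k y <= layer k x.
Proof.
intros Hk Hxy; unfold layer.
destruct Hxy as [H| ->]; [|lra]. left; apply exp_increasing; nra.
Qed.

Lemma is_derive_layer (C k x0 x : R) :
  is_derive (fun y => C * layer k (y - x0)) x (- (C * k) * layer k (x - x0)).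
Proof. unfold layer; auto_derive; [trivial|unfold Rminus; ring]. Qed.

Definition decays_like_layer (M eps k : R) (w w1 w2 : R -> R) : Prop :=
  forall x, 0 < x < 1 ->
    Rabs (w x) <= M * layer k x /\
    eps * Rabs (w1 x) <= M * layer k x /\
    eps ^ 2 * Rabs (w2 x) <= M * layer k x.

Lemma homogeneous_solution_opp (eps : R) (b c w w1 w2 : R -> R) :
  homogeneous_solution eps b c w w1 w2 ->
  homogeneous_solution eps b c
    (fun x => - w x) (fun x => - w1 x) (fun x => - w2 x).
Proof.
intros [H1 [H2 H3]]; split; [|split]; intros x Hx.
- apply continuity_pt_opp; auto.
- destruct (H2 x Hx); split; now apply (@is_derive_opp R_AbsRing R_NormedModule).
- specialize (H3 x Hx); lra.
Qed.

(** On [exp (- k x)] with [k = beta / eps] the operator produces the positive factor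
    [k (b - beta) + c], so [W] times the layer is a strict supersolution that dominates both
    boundary values. *)
Lemma layer_upper_bound (eps beta W : R) (b c w w1 w2 : R -> R) :
  0 < eps -> 0 < beta -> 0 < W ->
  (forall x, 0 < x < 1 -> beta < b x) ->
  (forall x, 0 < x < 1 -> 0 <= c x) ->
  homogeneous_solution eps b c w w1 w2 ->
  w 0 <= W -> w 1 = 0 ->
  forall x, 0 <= x <= 1 -> w x <= W * layer (beta / eps) x.
Proof.
intros He Hb HW Bb Bc [Hc [Hd HL]] H0 H1 x Hx.
set (k := beta / eps).
assert (Ek : beta = eps * k) by (unfold k; field; lra).
assert (Pk : 0 < k) by (unfold k; apply Rdiv_lt_0_compat; lra).
set (g := fun C y => C * layer k (y - 0)).
assert (Eg : forall y, g W y = W * layer k y).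
{ intros; unfold g; now rewrite Rminus_0_r. }
cut (w x - g W x <= 0); [rewrite Eg; lra|].
apply (maximum_principle eps b c (fun y => w y - g W y)
  (fun y => w1 y - g (- (W * k)) y) (fun y => w2 y - g (- (- (W * k) * k)) y)); auto.
- intros y Hy; destruct (Hd y Hy); split;
    apply (@is_derive_minus R_AbsRing R_NormedModule); auto; apply is_derive_layer.
- intros y Hy; apply continuity_pt_minus; auto.
  eapply is_derive_continuity, is_derive_layer.
- rewrite Eg, layer_0; lra.
- rewrite Eg, H1; pose proof (layer_pos k 1); nra.
- intros y Hy; specialize (HL y Hy); specialize (Bb y Hy); specialize (Bc y Hy).
  unfold g; rewrite Rminus_0_r.
  pose proof (layer_pos k y) as P.
  assert (0 < W * layer k y * (k * (b y - eps * k) + c y)).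
  { apply Rmult_lt_0_compat; [nra|].
    assert (0 < k * (b y - eps * k)) by (apply Rmult_lt_0_compat; lra). lra. }
  nra.
Qed.

Lemma layer_bound (eps beta W : R) (b c w w1 w2 : R -> R) :
  0 < eps -> 0 < beta -> 0 < W ->
  (forall x, 0 < x < 1 -> beta < b x) ->
  (forall x, 0 < x < 1 -> 0 <= c x) ->
  homogeneous_solution eps b c w w1 w2 ->
  Rabs (w 0) <= W -> w 1 = 0 ->
  forall x, 0 <= x <= 1 -> Rabs (w x) <= W * layer (beta / eps) x.
Proof.
intros He Hb HW Bb Bc Hw H0 H1 x Hx. apply Rabs_le_between in H0.
apply Rabs_le_between; split.
- cut (- w x <= W * layer (beta / eps) x); [lra|].
  apply (layer_upper_bound eps beta W b c (fun x => - w x)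
    (fun x => - w1 x) (fun x => - w2 x)); auto; try lra.
  now apply homogeneous_solution_opp.
- eapply layer_upper_bound; eauto; lra.
Qed.

(* The flux [eps w' + b w] has derivative [(b' + c) w], which is of the size of
   [w]; so a bound for [w'] at one point spreads over an interval of length
   [eps / 2] without loss of powers of [eps]. *)
Lemma layer_derivative_bounds (beta K W : R) :
  0 < beta -> 0 < K -> 0 < W -> exists M, 0 < M /\
  forall (eps : R) (b b1 b2 c w w1 w2 : R -> R),
  0 < eps < 1 ->
  (forall x, 0 < x < 1 -> beta < b x) ->
  (forall x, 0 < x < 1 -> 0 <= c x <= K) ->
  C2_bounded K b b1 b2 ->
  homogeneous_solution eps b c w w1 w2 ->
  Rabs (w 0) <= W -> w 1 = 0 ->
  decays_like_layer M eps (beta / eps) w w1 w2.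
Proof.
intros Hb HK HW.
(* The 4 comes from a difference quotient over length [eps / 2]; the change of the flux and two
   values of [b w] need [3 * K], rounded up; [exp (beta / 2)] is the variation of the layer over
   that length. *)
set (M1 := (4 + 4 * K) * W * exp (beta / 2)).
assert (P1 : 1 < exp (beta / 2)) by (rewrite <- exp_0; apply exp_increasing; lra).
assert (PM : W <= M1).
{ unfold M1. assert (0 < K * W) by nra.
  assert (W * 1 <= W * exp (beta / 2)) by (apply Rmult_le_compat_l; lra).
  assert (0 < K * W * exp (beta / 2)) by nra. nra. }
exists ((1 + 2 * K) * M1); split; [apply Rmult_lt_0_compat; lra|].
intros eps b b1 b2 c w w1 w2 He Bb Bc HB Hw H0 H1.
assert (HW0 : forall x, 0 <= x <= 1 -> Rabs (w x) <= W * layer (beta / eps) x).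
{ eapply layer_bound; eauto; try lra. intros; apply Bc; auto. }
destruct Hw as [Hc [Hd HL]].
set (k := beta / eps) in *.
assert (Pk : 0 < k) by (unfold k; apply Rdiv_lt_0_compat; lra).
assert (B1 : forall x, 0 < x < 1 -> eps * Rabs (w1 x) <= M1 * layer k x).
{ intros x Hx.
  (* The interval of length [eps / 2] starts at [x] in the left half of [[0,1]] and ends at [x]
     otherwise, so it never leaves [[0,1]]. *)
  assert (Hp : exists p, 0 <= p /\ p + eps / 2 <= 1 /\ p <= x <= p + eps / 2).
  { destruct (Rle_dec x (1 / 2)); [exists x|exists (x - eps / 2)]; lra. }
  destruct Hp as [p [Hp0 [Hp1 Hpx]]].
  set (q := p + eps / 2) in *.
  assert (Wp : forall t, p <= t <= q -> Rabs (w t) <= W * layer k p).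
  { intros t Ht; eapply Rle_trans; [apply HW0; lra|].
    apply Rmult_le_compat_l; [lra|]. apply layer_antitone; lra. }
  assert (Ep : layer k p <= exp (beta / 2) * layer k x).
  { unfold layer; rewrite <- exp_plus.
    assert (- (k * p) <= beta / 2 + - (k * x)).
    { assert (E : beta / 2 = k * (eps / 2)) by (unfold k; field; lra).
      rewrite E; unfold q in Hpx; nra. }
    destruct H as [H|H]; [left; now apply exp_increasing|rewrite H; lra]. }
  destruct (mean_value w w1 p q) as [y [Hy Ey]].
  { unfold q; lra. } { intros; apply Hd; lra. } { intros; apply Hc; lra. }
  assert (A1 : eps * Rabs (w1 y) <= 4 * (W * layer k p)).
  { assert (Eq : eps * w1 y = 2 * (w q - w p)) by (rewrite Ey; unfold q; field).
    rewrite <- (Rabs_right eps) at 1 by lra. rewrite <- Rabs_mult, Eq.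
    assert (Q1 := Wp q ltac:(unfold q; lra)); assert (Q2 := Wp p ltac:(unfold q; lra)).
    unfold Rabs in *; repeat destruct Rcase_abs; lra. }
  assert (A2 : Rabs ((eps * w1 x + b x * w x) - (eps * w1 y + b y * w y))
               <= (2 * K * (W * layer k p)) * Rabs (x - y)).
  { assert (D : forall t, 0 < t < 1 ->
      is_derive (fun z => eps * w1 z + b z * w z) t ((b1 t + c t) * w t)).
    { intros t Ht; destruct (Hd t Ht) as [D1 D2]; destruct (HB t Ht) as [D3 _].
      replace ((b1 t + c t) * w t) with (eps * w2 t + (b1 t * w t + b t * w1 t))
        by (specialize (HL t Ht); lra).
      apply (@is_derive_plus R_AbsRing R_NormedModule).
      - now apply is_derive_scal.
      - apply (is_derive_mult b w); auto; intros; apply Rmult_comm. }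
    assert (Bd : forall t, p <= t <= q -> 0 < t < 1 ->
      Rabs ((b1 t + c t) * w t) <= 2 * K * (W * layer k p)).
    { intros t Ht Ht1; rewrite Rabs_mult.
      destruct (HB t Ht1) as [_ [_ [_ [D3 _]]]]; specialize (Bc t Ht1).
      apply Rmult_le_compat; try apply Rabs_pos; [|now apply Wp].
      eapply Rle_trans; [apply Rabs_triang|]. rewrite (Rabs_right (c t)) by lra. lra. }
    eapply (derive_bound_lipschitz _ _ _ 0 1 y x ltac:(lra) Hx D).
    intros t Ht Hty; apply Bd; lra. }
  assert (A3 : forall t, p <= t <= q -> 0 < t < 1 ->
    Rabs (b t * w t) <= K * (W * layer k p)).
  { intros t Ht Ht1; rewrite Rabs_mult.
    apply Rmult_le_compat; try apply Rabs_pos; [|now apply Wp].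
    destruct (HB t Ht1) as [_ [_ [? _]]]; auto. }
  assert (A4 := A3 x Hpx Hx). assert (A5 := A3 y ltac:(lra) ltac:(lra)).
  assert (PL : 0 < W * layer k p) by (pose proof (layer_pos k p); nra).
  assert (A6 : (2 * K * (W * layer k p)) * Rabs (x - y) <= K * (W * layer k p)).
  { assert (Rabs (x - y) <= 1 / 2).
    { apply Rabs_le_between; unfold q in *; lra. }
    assert (0 < K * (W * layer k p)) by nra. nra. }
  assert (A7 : eps * Rabs (w1 x) <= (4 + 3 * K) * (W * layer k p)).
  { rewrite <- (Rabs_right eps) in A1 |- * at 1 by lra.
    rewrite <- Rabs_mult in A1 |- *.
    assert (A8 : Rabs (eps * w1 x) <= Rabs ((eps * w1 x + b x * w x) - (eps * w1 y + b y * w y))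
      + Rabs (b x * w x) + Rabs (eps * w1 y) + Rabs (b y * w y)).
    { unfold Rabs; repeat destruct Rcase_abs; lra. }
    lra. }
  eapply Rle_trans; [exact A7|]. unfold M1.
  replace ((4 + 4 * K) * W * exp (beta / 2) * layer k x)
    with ((4 + 4 * K) * (W * (exp (beta / 2) * layer k x))) by ring.
  assert (W * layer k p <= W * (exp (beta / 2) * layer k x))
    by (apply Rmult_le_compat_l; lra).
  apply Rmult_le_compat; lra. }
intros x Hx. pose proof (layer_pos k x) as PL.
assert (PML : M1 * layer k x <= (1 + 2 * K) * M1 * layer k x).
{ assert (0 < K * (M1 * layer k x)) by (repeat apply Rmult_lt_0_compat; lra). lra. }
assert (PW : W * layer k x <= M1 * layer k x) by (apply Rmult_le_compat_r; lra).
assert (B0 := HW0 x ltac:(lra)). assert (B1x := B1 x Hx).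
repeat split; try lra.
(* The equation expresses [eps * w2] through [w] and [w1]; this is the source of [2 * K] in the
   final constant. *)
assert (E2 : eps * w2 x = c x * w x - b x * w1 x) by (specialize (HL x Hx); lra).
replace (eps ^ 2 * Rabs (w2 x)) with (eps * Rabs (eps * w2 x))
  by (rewrite Rabs_mult, (Rabs_right eps) by lra; ring).
rewrite E2.
assert (T : Rabs (c x * w x - b x * w1 x) <= K * Rabs (w x) + K * Rabs (w1 x)).
{ eapply Rle_trans; [apply Rabs_triang|]. rewrite Rabs_Ropp, !Rabs_mult.
  destruct (HB x Hx) as [_ [_ [? _]]]. specialize (Bc x Hx).
  rewrite (Rabs_right (c x)) by lra.
  apply Rplus_le_compat; (apply Rmult_le_compat_r; [apply Rabs_pos|lra]). }
assert (T2 : eps * Rabs (w x) <= M1 * layer k x).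
{ pose proof (Rabs_pos (w x)). nra. }
assert (eps * Rabs (c x * w x - b x * w1 x)
  <= K * (eps * Rabs (w x)) + K * (eps * Rabs (w1 x))).
{ eapply Rle_trans; [apply Rmult_le_compat_l; [lra|exact T]|]. lra. }
assert (K * (eps * Rabs (w x)) <= K * (M1 * layer k x)) by (apply Rmult_le_compat_l; lra).
assert (K * (eps * Rabs (w1 x)) <= K * (M1 * layer k x)) by (apply Rmult_le_compat_l; lra).
assert (0 < M1 * layer k x) by (apply Rmult_lt_0_compat; lra).
lra.
Qed.

(** * Bounds for the fitting factor *)

Lemma exp_ge_quadratic (x : R) : 0 <= x -> 1 + x + x ^ 2 / 2 <= exp x.
Proof.
intros [Hx| <-]; [|rewrite exp_0; lra].
destruct (mean_value (fun y => exp y - (1 + y + y ^ 2 / 2))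
  (fun y => exp y - (1 + y)) 0 x Hx) as [y [Hy Ey]].
{ intros; auto_derive; [trivial|field]. }
{ intros y _; eapply is_derive_continuity; auto_derive; trivial. }
rewrite exp_0 in Ey. pose proof (exp_ineq1_le y). nra.
Qed.

Lemma sigma_val (rho : R) : 0 < rho -> Defs.sigma rho = 2 * rho / (exp (2 * rho) - 1).
Proof. intros H; unfold Defs.sigma; destruct Req_EM_T; [lra|reflexivity]. Qed.

Lemma sigma_pos (rho : R) : 0 < rho -> 0 < Defs.sigma rho.
Proof.
intros H; rewrite sigma_val by assumption.
apply Rdiv_lt_0_compat; [lra|]. pose proof (exp_ineq1 (2 * rho)). lra.
Qed.

(** [exp (2 rho) - 1] is at least [2 rho + 2 rho^2], and the product of this with the claimed bound
    is [2 rho + 2 rho^4]. Together with [sigma_ge] this gives [sigma rho = 1 - rho + O(rho^2)]. *)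
Lemma sigma_le_quadratic (rho : R) : 0 < rho -> Defs.sigma rho <= 1 - rho + rho ^ 2.
Proof.
intros H; rewrite sigma_val by assumption.
pose proof (exp_ge_quadratic (2 * rho) ltac:(lra)).
apply Rle_div_l; [nra|].
apply Rle_trans with ((1 - rho + rho ^ 2) * (2 * rho + 2 * rho ^ 2)).
- replace ((1 - rho + rho ^ 2) * (2 * rho + 2 * rho ^ 2))
    with (2 * rho + 2 * rho ^ 4) by ring.
  assert (0 < rho ^ 4) by (apply pow_lt; lra). lra.
- apply Rmult_le_compat_l; nra.
Qed.

Lemma sigma_le_1 (rho : R) : 0 < rho -> Defs.sigma rho <= 1.
Proof.
intros H; rewrite sigma_val by assumption.
pose proof (exp_ineq1_le (2 * rho)).
apply Rle_div_l; lra.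
Qed.

(** [2 y - (1 - y) (exp (2 y) - 1)] vanishes at 0 and has a nonnegative derivative, because
    [exp (- 2 y) >= 1 - 2 y]. *)
Lemma sigma_ge (rho : R) : 0 < rho -> 1 - rho <= Defs.sigma rho.
Proof.
intros H; rewrite sigma_val by assumption.
pose proof (exp_ineq1_le (2 * rho)).
apply Rle_div_r; [lra|].
destruct (mean_value (fun y => 2 * y - (1 - y) * (exp (2 * y) - 1))
  (fun y => 1 + (2 * y - 1) * exp (2 * y)) 0 rho H) as [y [Hy Ey]].
{ intros; auto_derive; [trivial|ring]. }
{ intros y _; eapply is_derive_continuity; auto_derive; trivial. }
rewrite Rmult_0_r, exp_0 in Ey.
assert (0 <= 1 + (2 * y - 1) * exp (2 * y)).
{ pose proof (exp_ineq1_le (- (2 * y))). pose proof (exp_pos (2 * y)).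
  assert (exp (2 * y) * exp (- (2 * y)) = 1)
    by (rewrite <- exp_plus, Rplus_opp_r; apply exp_0). nra. }
nra.
Qed.

(** * The three-point stencil and its mean value formulas *)

Definition second_difference (hm hp : R) (V : R -> R) (x : R) : R :=
  ((V (x + hp) - V x) / hp - (V x - V (x - hm)) / hm) / ((hm + hp) / 2).

(** The scheme without its reaction term, with frozen coefficient [b], acting on functions of a real
    variable so that calculus applies; [LN_stencil] links it to mesh functions. *)
Definition stencil (eps b hm hp : R) (V : R -> R) (x : R) : R :=
  - eps * Defs.sigma (b * hp / (2 * eps)) * second_difference hm hp V x
  - b * ((V (x + hp) - V x) / hp).

Lemma stencil_linear (eps b hm hp p q x : R) (V V1 V2 : R -> R) :
  stencil eps b hm hp (fun y => V y - p * V1 y - q * V2 y) x =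
  stencil eps b hm hp V x - p * stencil eps b hm hp V1 x
  - q * stencil eps b hm hp V2 x.
Proof. unfold stencil, second_difference, Rdiv; ring. Qed.

(* Fitting makes the uniform stencil exact on the span of [1], [y] and
   [exp (- b y / eps)], so Rolle applies to the error of interpolation there. *)
Lemma stencil_mean_value (eps b h x : R) (V V1 V2 : R -> R) :
  0 < eps -> 0 < b -> 0 < h ->
  (forall y, x - h < y < x + h -> is_derive V y (V1 y) /\ is_derive V1 y (V2 y)) ->
  (forall y, x - h <= y <= x + h -> continuity_pt V y) ->
  exists y, x - h < y < x + h /\
    stencil eps b h h V x = - eps * V2 y - b * V1 y.
Proof.
intros He Hb Hh Hd Hc.
set (s := stencil eps b h h V x).
set (k := b / eps).
assert (Pk : 0 < k) by (unfold k; apply Rdiv_lt_0_compat; lra).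
set (E := exp (k * h)).
assert (PE : 1 < E) by (unfold E; rewrite <- exp_0; apply exp_increasing; nra).
(* Fitting turns the stencil into a multiple of [E] times the forward minus the backward increment,
   which vanishes on constants and on [exp (- k y)]. *)
assert (Es : s = - (b / (h * (E - 1))) *
  (E * (V (x + h) - V x) - (V x - V (x - h)))).
{ unfold s, stencil, second_difference.
  rewrite sigma_val by (apply Rdiv_lt_0_compat; nra).
  replace (2 * (b * h / (2 * eps))) with (k * h) by (unfold k; field; lra).
  fold E. unfold k. field. repeat split; lra. }
(* [a] is fixed by the zero at [x + h]; the zero at [x] is built into [l], and the one at [x - h] is
   the formula for [s]. *)
set (a := (V (x + h) - V x + s / b * h) / (/ E - 1)).
assert (HE : / E - 1 <> 0).
{ pose proof (Rinv_1_lt_contravar 1 E). rewrite Rinv_1 in *. lra. }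
set (g := fun C y => C * layer k (y - x)).
assert (gm : forall C, g C (x - h) = C * E).
{ intros; unfold g, layer, E; do 2 f_equal; ring. }
assert (gp : forall C, g C (x + h) = C * / E).
{ intros; unfold g, layer, E; rewrite <- exp_Ropp; do 2 f_equal; ring. }
assert (g0 : forall C, g C x = C).
{ intros; unfold g; rewrite Rminus_diag, layer_0; ring. }
set (l := fun y => s / b * (y - x) - V x + a).
assert (Dl : forall y, is_derive l y (s / b)).
{ intros; unfold l; auto_derive; [trivial|ring]. }
destruct (three_zeros (fun y => (V y + l y) - g a y)
  (fun y => (V1 y + s / b) - g (- (a * k)) y)
  (fun y => (V2 y + 0) - g (- (- (a * k) * k)) y) k (x - h) x (x + h))
  as [y [Hy Ey]].
- lra.
- intros y Hy; destruct (Hd y Hy); split;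
    apply (@is_derive_minus R_AbsRing R_NormedModule); try apply is_derive_layer;
    apply (@is_derive_plus R_AbsRing R_NormedModule); auto.
  apply (@is_derive_const R_AbsRing R_NormedModule).
- intros y Hy; apply continuity_pt_minus.
  + apply continuity_pt_plus; auto. eapply is_derive_continuity, Dl.
  + eapply is_derive_continuity, is_derive_layer.
- rewrite gm; unfold l, a. rewrite Es.
  assert (E <> 1) by lra. field. repeat split; lra.
- rewrite g0; unfold l; ring.
- rewrite gp; unfold l, a. field. repeat split; try lra.
- exists y; split; [assumption|].
  (* The exponential cancels in [g2 + k * g1], which leaves [V2 + k V1 + k s / b = 0]. *)
  unfold g in Ey. replace s with (b * (s / b)) by (field; lra).
  assert (Ek : b = eps * k) by (unfold k; field; lra).
  revert Ey. generalize (s / b) as t; generalize (layer k (y - x)) as e; intros e t Ey.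
  rewrite Ek. nra.
Qed.

(** The interpolant [l] is the parabola through the three nodes, with second derivative [d]; its
    error has three zeros, so [three_zeros] with [k = 0] gives the point. *)
Lemma second_difference_mean_value (hm hp x : R) (V V1 V2 : R -> R) :
  0 < hm -> 0 < hp ->
  (forall y, x - hm < y < x + hp -> is_derive V y (V1 y) /\ is_derive V1 y (V2 y)) ->
  (forall y, x - hm <= y <= x + hp -> continuity_pt V y) ->
  exists y, x - hm < y < x + hp /\ second_difference hm hp V x = V2 y.
Proof.
intros Hm Hp Hd Hc.
set (d := second_difference hm hp V x).
set (a := (V (x + hp) - V x) / hp - d / 2 * hp).
set (l := fun y => V x + a * (y - x) + d / 2 * (y - x) ^ 2).
destruct (three_zeros (fun y => V y - l y)
  (fun y => V1 y - (a + d * (y - x))) (fun y => V2 y - d) 0 (x - hm) x (x + hp))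
  as [y [Hy Ey]].
- lra.
- intros y Hy; destruct (Hd y Hy); split;
    apply (@is_derive_minus R_AbsRing R_NormedModule); auto;
    [unfold l|]; auto_derive; trivial; unfold Rminus; field.
- intros y Hy; apply continuity_pt_minus; auto.
  apply is_derive_continuity with (a + d * (y - x)).
  unfold l; auto_derive; trivial; unfold Rminus; field.
- unfold l, a, d, second_difference; field. repeat split; lra.
- unfold l; ring.
- unfold l, a, d, second_difference; field. repeat split; lra.
- exists y; split; [assumption|lra].
Qed.

Lemma taylor_remainder (g g1 g2 : R -> R) (L p q x y : R) :
  p < x < q -> p < y < q ->
  (forall t, p < t < q -> is_derive g t (g1 t) /\ is_derive g1 t (g2 t)) ->
  (forall t, p < t < q -> x < t < y \/ y < t < x -> Rabs (g2 t) <= L) ->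
  Rabs (g y - g x - g1 x * (y - x)) <= L * (y - x) ^ 2.
Proof.
intros Hx Hy Hd Hb.
replace (g y - g x - g1 x * (y - x))
  with ((g y - g1 x * y) - (g x - g1 x * x)) by ring.
replace (L * (y - x) ^ 2) with (L * Rabs (y - x) * Rabs (y - x))
  by (rewrite <- (pow2_abs (y - x)); ring).
apply (derive_bound_lipschitz (fun t => g t - g1 x * t) (fun t => g1 t - g1 x) _ p q);
  auto.
- intros t Ht; destruct (Hd t Ht) as [D _].
  apply (@is_derive_minus R_AbsRing R_NormedModule); [assumption|].
  auto_derive; [trivial|ring].
- intros t Ht Hty.
  eapply Rle_trans.
  + apply (derive_bound_lipschitz g1 g2 L p q x t); auto.
    * intros; now apply Hd.
    * intros z Hz Hzt; apply Hb; lra.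
  + apply Rmult_le_compat_l.
    * eapply Rle_trans; [apply Rabs_pos|apply (Hb t Ht Hty)].
    * unfold Rabs; repeat destruct Rcase_abs; lra.
Qed.

(** * Truncation error on the layer component *)

(** By convexity the second difference is nonnegative, so the diffusion term only lowers the value;
    [(exp (- k h) - 1) / h >= - k] bounds the convection term. *)
Lemma stencil_layer_le (eps b h k x : R) :
  0 < eps -> 0 < b -> 0 < h -> 0 < k ->
  stencil eps b h h (fun y => layer k (y - x)) x <= b * k.
Proof.
intros He Hb Hh Hk. unfold stencil, second_difference.
replace (x + h - x) with h by ring. replace (x - h - x) with (- h) by ring.
rewrite Rminus_diag, layer_0.
set (rho := b * h / (2 * eps)).
assert (Pr : 0 < rho) by (unfold rho; apply Rdiv_lt_0_compat; nra).
pose proof (sigma_pos rho Pr).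
assert (E1 : layer k h * layer k (- h) = 1)
  by (rewrite <- layer_plus, Rplus_opp_r; apply layer_0).
pose proof (layer_pos k h); pose proof (layer_pos k (- h)).
assert (0 <= ((layer k h - 1) / h - (1 - layer k (- h)) / h) / ((h + h) / 2)).
{ replace (((layer k h - 1) / h - (1 - layer k (- h)) / h) / ((h + h) / 2))
    with ((layer k h + layer k (- h) - 2) / (h * h)) by (field; lra).
  apply Rle_div_r; [nra|]. rewrite Rmult_0_l.
  replace (layer k h + layer k (- h) - 2)
    with ((layer k h - 1) ^ 2 * layer k (- h)
          + (layer k h - 2) * (1 - layer k h * layer k (- h))) by ring.
  rewrite E1. assert (0 <= (layer k h - 1) ^ 2) by apply pow2_ge_0. nra. }
assert (0 <= eps * Defs.sigma rho *
  (((layer k h - 1) / h - (1 - layer k (- h)) / h) / ((h + h) / 2))).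
{ apply Rmult_le_pos; [nra|assumption]. }
assert (- k <= (layer k h - 1) / h).
{ apply Rle_div_r; [assumption|]. unfold layer.
  pose proof (exp_ineq1_le (- (k * h))). lra. }
nra.
Qed.

(** The function solves [- eps V'' - b V' = y - x], which is how it removes a linear residual. Its
    stencil at [x] is [eps / b] times [sigma rho - 1 + rho], of second order because fitting cancels
    the first-order term. *)
Lemma stencil_corrector_bound (eps b h x : R) :
  0 < eps -> 0 < b -> 0 < h ->
  Rabs (stencil eps b h h
    (fun y => - (y - x) ^ 2 / (2 * b) + eps * (y - x) / b ^ 2) x)
  <= b * h ^ 2 / eps.
Proof.
intros He Hb Hh.
unfold stencil, second_difference. set (rho := b * h / (2 * eps)).
assert (Pr : 0 < rho) by (unfold rho; apply Rdiv_lt_0_compat; nra).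
pose proof (sigma_le_quadratic rho Pr). pose proof (sigma_ge rho Pr).
match goal with |- Rabs ?t <= _ =>
  replace t with (eps / b * (Defs.sigma rho - 1 + rho)) end.
2:{ unfold rho at 2. field. lra. }
assert (P : 0 < eps / b) by (apply Rdiv_lt_0_compat; lra).
rewrite Rabs_right by nra.
apply Rle_trans with (eps / b * rho ^ 2); [apply Rmult_le_compat_l; lra|].
replace (eps / b * rho ^ 2) with (b * h ^ 2 / eps / 4) by (unfold rho; field; lra).
assert (0 < h ^ 2) by (apply pow_lt; assumption).
assert (0 < b * h ^ 2 / eps) by (apply Rdiv_lt_0_compat; nra). lra.
Qed.

Lemma square_scale_le (e z B : R) :
  0 < e < 1 -> 0 <= z -> e * z <= B -> e ^ 2 * z <= B.
Proof.
intros He Hz H.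
assert (0 <= e * z * (1 - e)) by (repeat apply Rmult_le_pos; lra). lra.
Qed.

(* Averaging [F y = (b y - b x) w' y - c y w y] against the stencil: the constant
   term is the residual, the linear term is removed by an explicit quadratic
   corrector, and the remainder, which grows like the layer to the left of [x],
   is dominated by a multiple of the layer function itself. *)
Lemma truncation_uniform_upper (eps beta delta K M h x : R)
  (b b1 b2 c c1 c2 w w1 w2 : R -> R) :
  0 < eps < 1 -> 0 < beta -> 0 < delta -> 0 < K -> 0 < M ->
  (forall y, 0 < y < 1 -> beta + delta <= b y) ->
  C2_bounded K b b1 b2 -> C2_bounded K c c1 c2 ->
  homogeneous_solution eps b c w w1 w2 ->
  decays_like_layer M eps (beta / eps) w w1 w2 ->
  0 < h -> 0 <= x - h -> x + h <= 1 ->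
  stencil eps (b x) h h w x + c x * w x
  <= (5 * K * M + 3 * K ^ 2 * M + 5 * K ^ 2 * M / delta)
     * ((h / eps) ^ 2 * layer (beta / eps) x).
Proof.
intros He Hbeta Hdelta HK HM Bb HB HC [Hcont [Hd HL]] Hw Hh Hx0 Hx1.
set (k := beta / eps) in *.
assert (Pk : 0 < k) by (unfold k; apply Rdiv_lt_0_compat; lra).
assert (Ix : 0 < x < 1) by lra.
set (P := layer k x). assert (PP : 0 < P) by apply layer_pos.
set (r := (h / eps) ^ 2).
assert (Er : eps ^ 2 * r = h ^ 2) by (unfold r; field; lra).
assert (Ph2 : 0 < h ^ 2) by (apply pow_lt; assumption).
assert (Pe2 : 0 < eps ^ 2) by (apply pow_lt; lra).
assert (Pr : 0 < r) by (unfold r; apply pow_lt, Rdiv_lt_0_compat; lra).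
assert (Bx := Bb x Ix).
destruct (Hw x Ix) as [Wx [W1x W2x]].
destruct (HB x Ix) as [_ [_ [Kb [Kb1 _]]]].
destruct (HC x Ix) as [_ [_ [Kc [Kc1 _]]]].
(* [F1] is the derivative at [y = x] of the residual [(b y - b x) w1 y - c y w y]. *)
set (F1 := b1 x * w1 x - c1 x * w x - c x * w1 x).
(* The operator with coefficient [b x] multiplies [V2] by [k (b x - beta)]; with this [kap],
   [kap * V2] absorbs exactly the part of the remainder proportional to [V2]. *)
set (kap := 5 * K * M * (r * P) / (k * (b x - beta))).
assert (PbK : 0 < k * (b x - beta)) by (apply Rmult_lt_0_compat; lra).
assert (Prp : 0 < r * P) by (apply Rmult_lt_0_compat; assumption).
assert (PKM : 0 < K * M) by (apply Rmult_lt_0_compat; assumption).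
assert (PKMrp : 0 < K * M * (r * P)) by (apply Rmult_lt_0_compat; assumption).
assert (Pkap : 0 < kap) by (unfold kap; apply Rdiv_lt_0_compat; lra).
set (V1 := fun y => - (y - x) ^ 2 / (2 * b x) + eps * (y - x) / b x ^ 2).
set (V2 := fun y => layer k (y - x)).
assert (R0 : forall y, x - h < y < x + h ->
  (b y - b x) * w1 y - c y * w y <=
  - c x * w x + F1 * (y - x) + 5 * K * M * (r * P) * (1 + V2 y)).
{ intros y Hy. assert (Iy : 0 < y < 1) by lra.
  (* [A] is the sum of the layer values at [x] and at [y], so it dominates the layer between them on
     whichever side [y] lies. *)
  set (s := y - x). set (A := P * (1 + V2 y)).
  assert (PV : 0 < V2 y) by apply layer_pos.
  assert (PA : 0 < A) by (apply Rmult_lt_0_compat; lra).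
  assert (HA : forall t, x <= t -> layer k t <= A).
  { intros t Ht; apply Rle_trans with P; [apply layer_antitone; lra|unfold A; nra]. }
  assert (HA' : forall t, y <= t -> layer k t <= A).
  { intros t Ht; apply Rle_trans with (layer k y); [apply layer_antitone; lra|].
    unfold A, V2, P. replace y with (x + (y - x)) at 1 by ring.
    rewrite layer_plus. pose proof (layer_pos k x). lra. }
  assert (HAm : forall t, x < t < y \/ y < t < x -> M * layer k t <= M * A).
  { intros t Ht; apply Rmult_le_compat_l; [lra|].
    destruct Ht; [apply HA|apply HA']; lra. }
  assert (HAy : M * layer k y <= M * A) by (apply Rmult_le_compat_l; [lra|apply HA'; lra]).
  assert (Hs2 : 0 <= s ^ 2 <= h ^ 2).
  { split; [apply pow2_ge_0|]. unfold s; nra. }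
  destruct (Hw y Iy) as [Wy [W1y W2y]].
  assert (Dz : forall g g1 g2, C2_bounded K g g1 g2 ->
     Rabs (g y - g x - g1 x * s) <= K * s ^ 2).
  { intros g g1 g2 Hg; unfold s; apply (taylor_remainder g g1 g2 K 0 1); auto.
    - intros t Ht; destruct (Hg t Ht); tauto.
    - intros t Ht _; apply Hg; auto. }
  assert (Db := Dz _ _ _ HB). assert (Dc := Dz _ _ _ HC).
  assert (Dw1 : eps ^ 2 * Rabs (w1 y - w1 x) <= M * A * Rabs s).
  { apply Rle_trans with (eps ^ 2 * (M * A / eps ^ 2 * Rabs s));
      [apply Rmult_le_compat_l; [lra|]|right; field; lra].
    apply (derive_bound_lipschitz w1 w2 _ 0 1); auto; [intros; now apply Hd|].
    intros t Ht Hty; apply Rle_div_r; [assumption|].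
    rewrite Rmult_comm; eapply Rle_trans; [apply Hw; assumption|auto]. }
  assert (Dw : eps * Rabs (w y - w x) <= M * A * Rabs s).
  { apply Rle_trans with (eps * (M * A / eps * Rabs s));
      [apply Rmult_le_compat_l; [lra|]|right; field; lra].
    apply (derive_bound_lipschitz w w1 _ 0 1); auto; [intros; now apply Hd|].
    intros t Ht Hty; apply Rle_div_r; [lra|].
    rewrite Rmult_comm; eapply Rle_trans; [apply Hw; assumption|auto]. }
  assert (Tw : eps ^ 2 * Rabs (w y - w x - w1 x * s) <= M * A * s ^ 2).
  { apply Rle_trans with (eps ^ 2 * (M * A / eps ^ 2 * s ^ 2));
      [apply Rmult_le_compat_l; [lra|]|right; field; lra].
    apply (taylor_remainder w w1 w2 _ 0 1); auto.
    intros t Ht Hty; apply Rle_div_r; [assumption|].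
    rewrite Rmult_comm; eapply Rle_trans; [apply Hw; assumption|auto]. }
  assert (PMA : 0 < M * A) by (apply Rmult_lt_0_compat; lra).
  assert (step : forall p q B1 B2, Rabs p <= B1 -> eps ^ 2 * Rabs q <= B2 ->
    eps ^ 2 * Rabs (p * q) <= B1 * B2).
  { intros p q B1 B2 H1 H2. rewrite Rabs_mult.
    replace (eps ^ 2 * (Rabs p * Rabs q)) with (Rabs p * (eps ^ 2 * Rabs q)) by ring.
    apply Rmult_le_compat; auto; try apply Rabs_pos.
    apply Rmult_le_pos; [lra|apply Rabs_pos]. }
  assert (weak : forall z B, eps * Rabs z <= B -> eps ^ 2 * Rabs z <= B).
  { intros z B H; apply square_scale_le; auto; apply Rabs_pos. }
  assert (weak0 : forall z B, Rabs z <= B -> eps ^ 2 * Rabs z <= B).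
  { intros z B H; apply square_scale_le; auto; [apply Rabs_pos|].
    pose proof (Rabs_pos z); nra. }
  assert (Ess : forall B1 B2, B1 * Rabs s * (B2 * Rabs s) = B1 * B2 * s ^ 2).
  { intros; rewrite <- (pow2_abs s); ring. }
  assert (T1 := step _ _ _ _ Db (weak _ _ (Rle_trans _ _ _ W1y HAy))).
  assert (S1 : Rabs (b1 x * s) <= K * Rabs s).
  { rewrite Rabs_mult; apply Rmult_le_compat_r; [apply Rabs_pos|assumption]. }
  assert (S2 : Rabs (c1 x * s) <= K * Rabs s).
  { rewrite Rabs_mult; apply Rmult_le_compat_r; [apply Rabs_pos|assumption]. }
  assert (T2 := step _ _ _ _ S1 Dw1). rewrite Ess in T2.
  assert (T3 := step _ _ _ _ Dc (weak0 _ _ (Rle_trans _ _ _ Wy HAy))).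
  assert (T4 := step _ _ _ _ S2 (weak _ _ Dw)). rewrite Ess in T4.
  assert (T5 := step _ _ _ _ Kc Tw).
  (* Expanding both products to second order leaves five remainders, each at most
     [K M A s^2 / eps^2]; hence the factor 5. *)
  set (X1 := (b y - b x - b1 x * s) * w1 y) in *.
  set (X2 := b1 x * s * (w1 y - w1 x)) in *.
  set (X3 := (c y - c x - c1 x * s) * w y) in *.
  set (X4 := c1 x * s * (w y - w x)) in *.
  set (X5 := c x * (w y - w x - w1 x * s)) in *.
  replace ((b y - b x) * w1 y - c y * w y)
    with (- c x * w x + F1 * s + (X1 + X2 - X3 - X4 - X5))
    by (unfold X1, X2, X3, X4, X5, F1; ring).
  cut (X1 + X2 - X3 - X4 - X5 <= 5 * K * M * (r * P) * (1 + V2 y)); [lra|].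
  apply Rmult_le_reg_l with (eps ^ 2); [assumption|].
  assert (Ea : forall z, eps ^ 2 * z <= eps ^ 2 * Rabs z /\ eps ^ 2 * (- z) <= eps ^ 2 * Rabs z).
  { intros z; split; apply Rmult_le_compat_l; try lra;
      [apply Rle_abs|rewrite <- Rabs_Ropp; apply Rle_abs]. }
  pose proof (Ea X1); pose proof (Ea X2); pose proof (Ea X3);
  pose proof (Ea X4); pose proof (Ea X5).
  apply Rle_trans with (5 * (K * (M * A) * s ^ 2)); [lra|].
  replace (eps ^ 2 * (5 * K * M * (r * P) * (1 + V2 y)))
    with (5 * (K * (M * A) * (eps ^ 2 * r))) by (unfold A; ring).
  rewrite Er. apply Rmult_le_compat_l; [lra|].
  apply Rmult_le_compat_l; [apply Rmult_le_pos; lra|lra]. }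
(* After both corrections the linear term and the multiple of [V2] drop out at the mean value point,
   wherever it lies. *)
assert (SV : stencil eps (b x) h h (fun y => w y - F1 * V1 y - kap * V2 y) x
  <= - c x * w x + 5 * K * M * (r * P)).
{ set (g := fun C y => C * layer k (y - x)).
  destruct (stencil_mean_value eps (b x) h x
    (fun y => (w y - F1 * V1 y) - g kap y)
    (fun y => (w1 y - F1 * (- (y - x) / b x + eps / b x ^ 2)) - g (- (kap * k)) y)
    (fun y => (w2 y - F1 * (- / b x)) - g (- (- (kap * k) * k)) y))
    as [y [Hy Ey]]; try lra.
  - intros y Hy; destruct (Hd y) as [D1 D2]; [lra|].
    split; apply (@is_derive_minus R_AbsRing R_NormedModule); try apply is_derive_layer;
      apply (@is_derive_minus R_AbsRing R_NormedModule); auto;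
      [unfold V1|]; auto_derive; trivial; unfold Rminus; field; lra.
  - intros y Hy. apply continuity_pt_minus; [apply continuity_pt_minus|].
    + apply Hcont; lra.
    + unfold V1; eapply is_derive_continuity; auto_derive; trivial.
    + eapply is_derive_continuity, is_derive_layer.
  - change (fun y => w y - F1 * V1 y - kap * V2 y) with
      (fun y => (w y - F1 * V1 y) - g kap y).
    rewrite Ey. specialize (R0 y Hy). assert (HLy := HL y ltac:(lra)).
    assert (E1 : - eps * w2 y - b x * w1 y = (b y - b x) * w1 y - c y * w y) by lra.
    apply Rle_trans with ((b y - b x) * w1 y - c y * w y - F1 * (y - x)
      - kap * (k * (b x - beta)) * V2 y).
    + rewrite <- E1. right. unfold g. fold (V2 y).
      replace beta with (eps * k) by (unfold k; field; lra). field. lra.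
    + replace (kap * (k * (b x - beta))) with (5 * K * M * (r * P))
        by (unfold kap; field; lra). lra. }
rewrite stencil_linear in SV.
assert (B1 : F1 * stencil eps (b x) h h V1 x <= 3 * K ^ 2 * M * (r * P)).
{ assert (Q1 := stencil_corrector_bound eps (b x) h x ltac:(lra) ltac:(lra) Hh).
  fold V1 in Q1.
  assert (Q2 : eps * Rabs F1 <= 3 * K * M * P).
  { assert (Z : Rabs F1 <= K * Rabs (w1 x) + K * Rabs (w x) + K * Rabs (w1 x)).
    { unfold F1. eapply Rle_trans; [apply Rabs_triang|]. rewrite Rabs_Ropp, Rabs_mult.
      apply Rplus_le_compat; [|apply Rmult_le_compat_r; [apply Rabs_pos|assumption]].
      eapply Rle_trans; [apply Rabs_triang|]. rewrite Rabs_Ropp, !Rabs_mult.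
      apply Rplus_le_compat; (apply Rmult_le_compat_r; [apply Rabs_pos|assumption]). }
    apply Rle_trans with (eps * (K * Rabs (w1 x) + K * Rabs (w x) + K * Rabs (w1 x)));
      [apply Rmult_le_compat_l; lra|].
    replace (eps * (K * Rabs (w1 x) + K * Rabs (w x) + K * Rabs (w1 x)))
      with (K * (2 * (eps * Rabs (w1 x)) + eps * Rabs (w x))) by ring.
    replace (3 * K * M * P) with (K * (3 * (M * P))) by ring.
    apply Rmult_le_compat_l; [lra|]. fold P in Wx, W1x.
    assert (eps * Rabs (w x) <= M * P) by (pose proof (Rabs_pos (w x)); nra). lra. }
  eapply Rle_trans; [apply Rle_abs|]. rewrite Rabs_mult.
  apply Rle_trans with (Rabs F1 * (eps * (K * r))).
  - apply Rmult_le_compat_l; [apply Rabs_pos|]. eapply Rle_trans; [exact Q1|].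
    replace (eps * (K * r)) with (K * h ^ 2 / eps) by (rewrite <- Er; field; lra).
    apply Rmult_le_compat_r; [left; now apply Rinv_0_lt_compat|].
    apply Rmult_le_compat_r; [lra|]. rewrite Rabs_right in Kb; lra.
  - replace (Rabs F1 * (eps * (K * r))) with (eps * Rabs F1 * (K * r)) by ring.
    replace (3 * K ^ 2 * M * (r * P)) with (3 * K * M * P * (K * r)) by ring.
    apply Rmult_le_compat_r; [nra|assumption]. }
(* The gap [delta] enters here: [b x / (b x - beta)] is at most [K / delta]. *)
assert (B2 : kap * stencil eps (b x) h h V2 x <= 5 * K ^ 2 * M / delta * (r * P)).
{ assert (Q1 := stencil_layer_le eps (b x) h k x ltac:(lra) ltac:(lra) Hh Pk).
  fold V2 in Q1.
  apply Rle_trans with (kap * (b x * k)); [apply Rmult_le_compat_l; lra|].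
  replace (kap * (b x * k)) with (5 * K * M * (r * P) * (b x * / (b x - beta)))
    by (unfold kap; field; lra).
  replace (5 * K ^ 2 * M / delta * (r * P)) with (5 * K * M * (r * P) * (K * / delta))
    by (field; lra).
  apply Rmult_le_compat_l; [lra|].
  apply Rmult_le_compat; try lra.
  - left; apply Rinv_0_lt_compat; lra.
  - rewrite Rabs_right in Kb; lra.
  - apply Rinv_le_contravar; lra. }
lra.
Qed.

Lemma truncation_uniform (eps beta delta K M h x : R)
  (b b1 b2 c c1 c2 w w1 w2 : R -> R) :
  0 < eps < 1 -> 0 < beta -> 0 < delta -> 0 < K -> 0 < M ->
  (forall y, 0 < y < 1 -> beta + delta <= b y) ->
  C2_bounded K b b1 b2 -> C2_bounded K c c1 c2 ->
  homogeneous_solution eps b c w w1 w2 ->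
  decays_like_layer M eps (beta / eps) w w1 w2 ->
  0 < h -> 0 <= x - h -> x + h <= 1 ->
  Rabs (stencil eps (b x) h h w x + c x * w x)
  <= (5 * K * M + 3 * K ^ 2 * M + 5 * K ^ 2 * M / delta)
     * ((h / eps) ^ 2 * layer (beta / eps) x).
Proof.
intros He Hbeta Hdelta HK HM Bb HB HC Hh Hw Ph Hx0 Hx1.
apply Rabs_le_between; split.
- assert (U : stencil eps (b x) h h (fun y => - w y) x + c x * - w x
    <= (5 * K * M + 3 * K ^ 2 * M + 5 * K ^ 2 * M / delta)
     * ((h / eps) ^ 2 * layer (beta / eps) x)).
  { apply (truncation_uniform_upper eps beta delta K M h x b b1 b2 c c1 c2
      (fun y => - w y) (fun y => - w1 y) (fun y => - w2 y)); auto.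
    - now apply homogeneous_solution_opp.
    - intros y Hy; rewrite !Rabs_Ropp; auto. }
  replace (stencil eps (b x) h h (fun y => - w y) x)
    with (- stencil eps (b x) h h w x) in U
    by (unfold stencil, second_difference, Rdiv; ring).
  lra.
- now apply (truncation_uniform_upper eps beta delta K M h x b b1 b2 c c1 c2 w w1 w2).
Qed.

(** Exactness on the exponential is lost where the step jumps. The differences are instead replaced
    by [w2 z] and [w1 y] and compared with the equation at [z]; each discrepancy yields one factor
    [hp], and the layer at the left node bounds all values. *)
Lemma truncation_nonuniform (eps k K M hm hp x : R)
  (b b1 b2 c c1 c2 w w1 w2 : R -> R) :
  0 < eps < 1 -> 0 < k -> 0 < K -> 0 < M ->
  0 < b x ->
  C2_bounded K b b1 b2 -> C2_bounded K c c1 c2 ->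
  homogeneous_solution eps b c w w1 w2 ->
  decays_like_layer M eps k w w1 w2 ->
  0 < hm <= hp -> 0 <= x - hm -> x + hp <= 1 ->
  Rabs (stencil eps (b x) hm hp w x + c x * w x)
  <= 6 * (K * M) * (hp / eps ^ 2 * layer k (x - hm)).
Proof.
intros He Pk HK HM Bb HB HC [Hcont [Hd HL]] Hw Hh Hx0 Hx1.
assert (Ix : 0 < x < 1) by lra.
set (P := layer k (x - hm)). assert (PP : 0 < P) by apply layer_pos.
assert (PKM : 0 < K * M) by (apply Rmult_lt_0_compat; assumption).
assert (Pe2 : 0 < eps ^ 2) by (apply pow_lt; lra).
assert (Hd' : forall y, x - hm < y < x + hp ->
  is_derive w y (w1 y) /\ is_derive w1 y (w2 y)) by (intros; apply Hd; lra).
destruct (second_difference_mean_value hm hp x w w1 w2) as [z [Hz Ez]]; try lra; auto.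
{ intros; apply Hcont; lra. }
destruct (mean_value w w1 x (x + hp)) as [y [Hy Ey]]; try lra.
{ intros; apply Hd; lra. } { intros; apply Hcont; lra. }
assert (Iz : 0 < z < 1) by lra. assert (Iy : 0 < y < 1) by lra.
assert (Bd : forall t, x - hm < t < x + hp ->
  Rabs (w t) <= M * P /\ eps * Rabs (w1 t) <= M * P /\ eps ^ 2 * Rabs (w2 t) <= M * P).
{ intros t Ht. destruct (Hw t) as [A1 [A2 A3]]; [lra|].
  assert (M * layer k t <= M * P)
    by (apply Rmult_le_compat_l; [lra|apply layer_antitone; lra]).
  repeat split; lra. }
set (rho := b x * hp / (2 * eps)).
assert (Pr : 0 < rho) by (unfold rho; apply Rdiv_lt_0_compat; nra).
pose proof (sigma_ge rho Pr). pose proof (sigma_le_1 rho Pr).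
assert (lipg : forall g g1 g2, C2_bounded K g g1 g2 ->
  Rabs (g z - g x) <= K * hp).
{ intros g g1 g2 Hg. apply Rle_trans with (K * Rabs (z - x)).
  - apply (derive_bound_lipschitz g g1 K 0 1); auto; intros; now apply Hg.
  - apply Rmult_le_compat_l; [lra|]. apply Rabs_le_between; lra. }
assert (L1 := lipg _ _ _ HB). assert (L2 := lipg _ _ _ HC).
assert (L3 : eps * Rabs (w z - w x) <= M * P * hp).
{ apply Rle_trans with (eps * (M * P / eps * Rabs (z - x)));
    [apply Rmult_le_compat_l; [lra|]|].
  - apply (derive_bound_lipschitz w w1 _ (x - hm) (x + hp)); auto; try lra;
      [intros; now apply Hd'|].
    intros t Ht _; apply Rle_div_r; [lra|]. rewrite Rmult_comm; now apply Bd.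
  - replace (eps * (M * P / eps * Rabs (z - x))) with (M * P * Rabs (z - x))
      by (field; lra).
    apply Rmult_le_compat_l; [nra|]. apply Rabs_le_between; lra. }
assert (L4 : eps ^ 2 * Rabs (w1 z - w1 y) <= 2 * (M * P * hp)).
{ apply Rle_trans with (eps ^ 2 * (M * P / eps ^ 2 * Rabs (z - y)));
    [apply Rmult_le_compat_l; [lra|]|].
  - apply (derive_bound_lipschitz w1 w2 _ (x - hm) (x + hp)); auto; try lra;
      [intros; now apply Hd'|].
    intros t Ht _; apply Rle_div_r; [lra|]. rewrite Rmult_comm; now apply Bd.
  - replace (eps ^ 2 * (M * P / eps ^ 2 * Rabs (z - y))) with (M * P * Rabs (z - y))
      by (field; lra).
    replace (2 * (M * P * hp)) with (M * P * (2 * hp)) by ring.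
    apply Rmult_le_compat_l; [nra|]. apply Rabs_le_between; lra. }
destruct (HB x Ix) as [_ [_ [Kb _]]]. destruct (HB z Iz) as [_ [_ [Kbz _]]].
destruct (HC x Ix) as [_ [_ [Kc _]]].
destruct (Bd z Hz) as [Wz [_ W2z]].
destruct (Bd y ltac:(lra)) as [_ [W1y _]].
assert (PMP : 0 < M * P) by nra.
assert (step : forall p q B1 B2, Rabs p <= B1 -> eps ^ 2 * Rabs q <= B2 ->
  eps ^ 2 * Rabs (p * q) <= B1 * B2).
{ intros p q B1 B2 H1 H2. rewrite Rabs_mult.
  replace (eps ^ 2 * (Rabs p * Rabs q)) with (Rabs p * (eps ^ 2 * Rabs q)) by ring.
  apply Rmult_le_compat; auto; try apply Rabs_pos.
  apply Rmult_le_pos; [lra|apply Rabs_pos]. }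
assert (weak : forall t B, eps * Rabs t <= B -> eps ^ 2 * Rabs t <= B).
{ intros t B Ht; apply square_scale_le; auto; apply Rabs_pos. }
assert (weak0 : forall t B, Rabs t <= B -> eps ^ 2 * Rabs t <= B).
{ intros t B Ht; apply square_scale_le; auto; [apply Rabs_pos|].
  pose proof (Rabs_pos t); nra. }
assert (Sg : Rabs (eps * (1 - Defs.sigma rho)) <= K * hp).
{ rewrite Rabs_right by nra.
  apply Rle_trans with (eps * rho); [apply Rmult_le_compat_l; lra|].
  replace (eps * rho) with (b x * hp / 2) by (unfold rho; field; lra).
  rewrite Rabs_right in Kb by lra. nra. }
assert (T1 := step _ _ _ _ Sg W2z).
assert (T2 := step _ _ _ _ L2 (weak0 _ _ Wz)).
assert (T3 := step _ _ _ _ Kc (weak _ _ L3)).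
assert (T4 := step _ _ _ _ Kbz L4).
assert (T5 := step _ _ _ _ L1 (weak _ _ W1y)).
(* The weights are 1, 1, 1, 2, 1, with sum 6; the 2 arises because [z] and [y] may be
   [hm + hp <= 2 * hp] apart. *)
set (X1 := eps * (1 - Defs.sigma rho) * w2 z) in *.
set (X2 := (c z - c x) * w z) in *.
set (X3 := c x * (w z - w x)) in *.
set (X4 := b z * (w1 z - w1 y)) in *.
set (X5 := (b z - b x) * w1 y) in *.
assert (Et : stencil eps (b x) hm hp w x + c x * w x = X1 - X2 - X3 + X4 + X5).
{ unfold stencil. fold rho. rewrite Ez.
  replace ((w (x + hp) - w x) / hp) with (w1 y) by (rewrite Ey; field; lra).
  specialize (HL z Iz). unfold X1, X2, X3, X4, X5. lra. }
rewrite Et.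
assert (Tr : Rabs (X1 - X2 - X3 + X4 + X5)
  <= Rabs X1 + Rabs X2 + Rabs X3 + Rabs X4 + Rabs X5).
{ clear. unfold Rabs; repeat destruct Rcase_abs; lra. }
apply Rmult_le_reg_l with (eps ^ 2); [assumption|].
replace (eps ^ 2 * (6 * (K * M) * (hp / eps ^ 2 * P)))
  with (6 * (K * (M * P) * hp)) by (field; lra).
apply Rle_trans with (eps ^ 2 * (Rabs X1 + Rabs X2 + Rabs X3 + Rabs X4 + Rabs X5));
  [apply Rmult_le_compat_l; lra|].
lra.
Qed.

(** * Discrete maximum principle and the action of the scheme *)

Lemma finite_argmax (V : nat -> R) (N : nat) :
  exists m, (m <= N)%nat /\ forall i, (i <= N)%nat -> V i <= V m.
Proof.
induction N as [|N [m [Hm IH]]].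
- exists 0%nat; split; [lia|]. intros i Hi; replace i with 0%nat by lia; lra.
- destruct (Rle_dec (V m) (V (S N))) as [H|H].
  + exists (S N); split; [lia|]. intros i Hi.
    destruct (Nat.eq_dec i (S N)) as [->|]; [lra|].
    specialize (IH i ltac:(lia)); lra.
  + exists m; split; [lia|]. intros i Hi.
    destruct (Nat.eq_dec i (S N)) as [->|]; [lra|]. apply IH; lia.
Qed.

Lemma rho_pos (eps : R) (b : R -> R) (x : nat -> R) (i : nat) :
  0 < eps -> 0 < b (x i) -> 0 < hstep x (S i) -> 0 < rho_i eps b x i.
Proof.
intros He Hb Hh; unfold rho_i; apply Rdiv_lt_0_compat; [apply Rmult_lt_0_compat|]; lra.
Qed.

(** At a positive maximum the forward difference is nonpositive, the backward one nonnegative and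
    [D2] nonpositive, so all three terms of [LN] are nonnegative, whatever the ratio of step to
    [eps]. *)
Lemma discrete_maximum_principle (eps : R) (b c : R -> R) (x V : nat -> R) (N : nat) :
  0 < eps ->
  (forall i, (1 <= i <= N)%nat -> 0 < hstep x i) ->
  (forall i, (1 <= i <= N - 1)%nat -> 0 < b (x i) /\ 0 <= c (x i)) ->
  V 0%nat <= 0 -> V N <= 0 ->
  (forall i, (1 <= i <= N - 1)%nat -> LN eps b c x V i < 0) ->
  forall i, (i <= N)%nat -> V i <= 0.
Proof.
intros He Hh Hbc V0 VN HL i Hi.
destruct (finite_argmax V N) as [m [Hm Im]].
destruct (Rle_or_lt (V m) 0) as [|Pm]; [specialize (Im i Hi); lra|].
assert (Rm : (1 <= m <= N - 1)%nat).
{ destruct (Nat.eq_dec m 0) as [->|]; [lra|].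
  destruct (Nat.eq_dec m N) as [->|]; [lra|]. lia. }
exfalso. specialize (HL m Rm). destruct (Hbc m Rm) as [Bm Cm].
assert (H1 := Hh m ltac:(lia)). assert (H2 := Hh (S m) ltac:(lia)).
assert (I1 := Im (m - 1)%nat ltac:(lia)). assert (I2 := Im (S m) ltac:(lia)).
assert (Q1 : Dplus x V m <= 0).
{ unfold Dplus. apply Rle_div_l; lra. }
assert (Q2 : 0 <= Defs.Dminus x V m).
{ unfold Defs.Dminus. apply Rle_div_r; lra. }
assert (Q3 : Defs.D2 x V m <= 0).
{ unfold Defs.D2, hbar. apply Rle_div_l; lra. }
pose proof (sigma_pos _ (rho_pos eps b x m He Bm H2)) as Ps.
assert (Q4 : 0 <= eps * Defs.sigma (rho_i eps b x m) * - Defs.D2 x V m).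
{ apply Rmult_le_pos; [left; now apply Rmult_lt_0_compat|lra]. }
assert (Q5 : 0 <= b (x m) * - Dplus x V m) by (apply Rmult_le_pos; lra).
assert (Q6 : 0 <= c (x m) * V m) by (apply Rmult_le_pos; lra).
unfold LN in HL. lra.
Qed.

Lemma LN_linear (eps : R) (b c : R -> R) (x V V1 V2 : nat -> R) (p q r : R) (i : nat) :
  LN eps b c x (fun j => r * V j + p * V1 j + q * V2 j) i =
  r * LN eps b c x V i + p * LN eps b c x V1 i + q * LN eps b c x V2 i.
Proof. unfold LN, Defs.D2, Dplus, Defs.Dminus, Rdiv; ring. Qed.

(** Serves twice: for the linear reduced solution and for the barrier [2 - x]. *)
Lemma LN_affine (eps : R) (b c : R -> R) (x : nat -> R) (al ga : R) (i : nat) :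
  0 < hstep x i -> 0 < hstep x (S i) ->
  LN eps b c x (fun j => al * x j + ga) i = - b (x i) * al + c (x i) * (al * x i + ga).
Proof.
intros H1 H2. unfold LN.
assert (E1 : Dplus x (fun j => al * x j + ga) i = al).
{ unfold Dplus, hstep in *. simpl Nat.sub in *. rewrite Nat.sub_0_r in *. field. lra. }
assert (E2 : Defs.Dminus x (fun j => al * x j + ga) i = al).
{ unfold Defs.Dminus, hstep in *. field. lra. }
unfold Defs.D2. rewrite E1, E2. unfold Rdiv. ring.
Qed.

Lemma LN_stencil (eps : R) (b c w : R -> R) (x : nat -> R) (i : nat) :
  LN eps b c x (fun j => w (x j)) i =
  stencil eps (b (x i)) (hstep x i) (hstep x (S i)) w (x i) + c (x i) * w (x i).
Proof.
unfold LN, stencil, second_difference, Defs.D2, Dplus, Defs.Dminus, hbar, rho_i.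
replace (x i + hstep x (S i)) with (x (S i))
  by (unfold hstep; simpl Nat.sub; rewrite Nat.sub_0_r; ring).
replace (x i - hstep x i) with (x (i - 1)%nat) by (unfold hstep; ring).
reflexivity.
Qed.

(** * The discrete layer barrier *)

(** The implicit Euler solution of [s' = - k s] with [s(0) = 1]: its backward difference at [i] is
    [- k] times its value at [i]. *)
Fixpoint decay_product (k : R) (x : nat -> R) (i : nat) : R :=
  match i with
  | 0%nat => 1
  | S j => decay_product k x j / (1 + k * hstep x (S j))
  end.

(** Each factor is handled by [1 + k h <= 1 + 2 k h <= exp (2 k h)]. With [k = beta / (2 eps)] the
    rate [2 k] is that of the layer in the truncation error. *)
Lemma decay_product_bounds (k : R) (x : nat -> R) (N : nat) :
  0 < k -> x 0%nat = 0 -> (forall i, (1 <= i <= N)%nat -> 0 < hstep x i) ->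
  forall i, (i <= N)%nat -> layer (2 * k) (x i) <= decay_product k x i <= 1.
Proof.
intros Hk H0 Hh. induction i as [|i IH]; intros Hi.
- rewrite H0, layer_0; simpl; lra.
- specialize (IH ltac:(lia)). specialize (Hh (S i) ltac:(lia)). simpl decay_product.
  set (h := hstep x (S i)) in *.
  assert (P : 0 < k * h) by (apply Rmult_lt_0_compat; assumption).
  pose proof (layer_pos (2 * k) (x i)).
  split; [|apply Rle_div_l; lra].
  replace (x (S i)) with (x i + h)
    by (unfold h, hstep; simpl Nat.sub; rewrite Nat.sub_0_r; ring).
  rewrite layer_plus. apply Rmult_le_compat; try lra; [left; apply layer_pos|].
  unfold layer; rewrite exp_Ropp. apply Rinv_le_contravar; [lra|].
  pose proof (exp_ineq1_le (2 * k * h)). lra.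
Qed.

(* The decay rate is half of the natural one because [h_{i+1} / hbar_i] may be as
   large as 2 where the step size jumps. *)
Lemma LN_decay_product (eps beta delta : R) (b c : R -> R) (x : nat -> R) (i : nat) :
  0 < eps -> 0 < beta -> 0 < delta -> (1 <= i)%nat ->
  beta + delta <= b (x i) -> 0 <= c (x i) ->
  0 < hstep x i -> 0 < hstep x (S i) ->
  0 < decay_product (beta / (2 * eps)) x i ->
  decay_product (beta / (2 * eps)) x i * (beta * delta / 2)
    / (eps + beta / 2 * hstep x (S i))
  <= LN eps b c x (decay_product (beta / (2 * eps)) x) i.
Proof.
intros He Hb Hd Hi Bi Ci H1 H2 HS.
set (k := beta / (2 * eps)) in *. set (s := decay_product k x) in *.
assert (Pk : 0 < k) by (unfold k; apply Rdiv_lt_0_compat; lra).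
assert (Ek : beta = 2 * eps * k) by (unfold k; field; lra).
set (hp := hstep x (S i)) in *. set (hm := hstep x i) in *.
assert (Pkp : 0 < k * hp) by (apply Rmult_lt_0_compat; assumption).
assert (Pkm : 0 < k * hm) by (apply Rmult_lt_0_compat; assumption).
assert (Es : s (S i) = s i / (1 + k * hp)) by reflexivity.
assert (Pq : 0 < s (S i)) by (rewrite Es; apply Rdiv_lt_0_compat; lra).
assert (Ei : s i = s (S i) * (1 + k * hp)) by (rewrite Es; field; lra).
assert (Em : s (i - 1)%nat = s i * (1 + k * hm)).
{ destruct i as [|j]; [lia|]. replace (S j - 1)%nat with j by lia.
  unfold s; simpl decay_product. fold hm. field. lra. }
assert (E1 : Dplus x s i = - k * s (S i)).
{ unfold Dplus. fold hp. rewrite Ei. field. lra. }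
assert (E2 : Defs.Dminus x s i = - k * s i).
{ unfold Defs.Dminus. fold hm. rewrite Em. field. lra. }
assert (Pq2 : 0 < k ^ 2 * s (S i)).
{ apply Rmult_lt_0_compat; [apply pow_lt|]; assumption. }
(* [D2] equals [k^2 s(S i)] times [hp / hbar], and that ratio is at most 2. *)
assert (B2 : Defs.D2 x s i <= 2 * k ^ 2 * s (S i)).
{ unfold Defs.D2, hbar. fold hm hp. rewrite E1, E2, Ei. apply Rle_div_l; [lra|].
  assert (0 < k ^ 2 * s (S i) * hm).
  { apply Rmult_lt_0_compat; assumption. }
  lra. }
pose proof (rho_pos eps b x i He ltac:(lra) H2) as Pr.
pose proof (sigma_pos _ Pr) as Ps. pose proof (sigma_le_1 _ Pr) as Ls.
assert (B3 : eps * Defs.sigma (rho_i eps b x i) * Defs.D2 x s i <= eps * (2 * k ^ 2 * s (S i))).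
{ apply Rle_trans with (eps * Defs.sigma (rho_i eps b x i) * (2 * k ^ 2 * s (S i))).
  - apply Rmult_le_compat_l; [left; now apply Rmult_lt_0_compat|assumption].
  - rewrite Rmult_assoc. apply Rmult_le_compat_l; [lra|].
    rewrite <- (Rmult_1_l (2 * k ^ 2 * s (S i))) at 2.
    apply Rmult_le_compat_r; lra. }
assert (B4 : 0 <= c (x i) * s i) by (apply Rmult_le_pos; lra).
assert (B5 : (2 * eps * k + delta) * (k * s (S i)) <= b (x i) * (k * s (S i))).
{ apply Rmult_le_compat_r; [left; now apply Rmult_lt_0_compat|lra]. }
unfold LN. rewrite E1.
(* The part [2 eps k = beta] of [b] pays for diffusion; what is left is [delta * k * s (S i)], which
   is the stated fraction. *)
replace (s i * (beta * delta / 2) / (eps + beta / 2 * hp)) with (delta * (k * s (S i))).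
2:{ rewrite Es, Ek. field. assert (0 < eps * (k * hp)) by (apply Rmult_lt_0_compat; lra). lra. }
lra.
Qed.

(** * Mesh steps and comparison with the barrier *)

Lemma mesh_fine (eps beta a lambda : R) (N J i : nat) :
  (i <= J)%nat ->
  meshpt eps beta a lambda N J i = INR i * (xi_tr eps beta a lambda / INR J).
Proof.
intros Hi; unfold meshpt; apply Nat.leb_le in Hi; now rewrite Hi.
Qed.

(** Both branches of the mesh agree at [i = J], so the coarse formula includes the transition point
    and the step [J + 1] comes out as coarse. *)
Lemma mesh_coarse (eps beta a lambda : R) (N J i : nat) :
  (0 < J <= i)%nat ->
  meshpt eps beta a lambda N J i =
  xi_tr eps beta a lambda + INR (i - J) * ((1 - xi_tr eps beta a lambda) / INR (N - J)).
Proof.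
intros Hi. destruct (Nat.eq_dec i J) as [->|Hn].
- rewrite mesh_fine by lia. rewrite Nat.sub_diag; simpl INR.
  unfold Rdiv; rewrite Rmult_0_l. field. apply not_0_INR; lia.
- unfold meshpt. destruct (Nat.leb_spec i J); [lia|reflexivity].
Qed.

Lemma hstep_fine (eps beta a lambda : R) (N J i : nat) :
  (1 <= i <= J)%nat ->
  hstep (meshpt eps beta a lambda N J) i = xi_tr eps beta a lambda / INR J.
Proof.
intros Hi; unfold hstep; rewrite !mesh_fine by lia.
rewrite minus_INR by lia. simpl (INR 1). ring.
Qed.

Lemma hstep_coarse (eps beta a lambda : R) (N J i : nat) :
  (0 < J < i)%nat ->
  hstep (meshpt eps beta a lambda N J) i =
  (1 - xi_tr eps beta a lambda) / INR (N - J).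
Proof.
intros Hi; unfold hstep; rewrite !mesh_coarse by lia.
replace (i - 1 - J)%nat with (i - J - 1)%nat by lia.
rewrite (minus_INR (i - J)) by lia. simpl (INR 1). ring.
Qed.

(** The barrier is [K1 s + K2 (2 - x)]: the scheme exceeds [beta] on [2 - x], which supplies
    strictness, and [s <= 1], [2 - x <= 2] give the final bound. *)
Lemma barrier_comparison (eps beta delta K1 K2 : R) (b c : R -> R) (x e : nat -> R) (N : nat) :
  0 < eps -> 0 < beta -> 0 < delta -> 0 <= K1 -> 0 < K2 ->
  x 0%nat = 0 ->
  (forall i, (i <= N)%nat -> 0 <= x i <= 1) ->
  (forall i, (1 <= i <= N)%nat -> 0 < hstep x i) ->
  (forall i, (1 <= i <= N - 1)%nat -> beta + delta <= b (x i) /\ 0 <= c (x i)) ->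
  e 0%nat = 0 -> e N = 0 ->
  (forall i, (1 <= i <= N - 1)%nat ->
    Rabs (LN eps b c x e i) <=
    K1 * (decay_product (beta / (2 * eps)) x i * (beta * delta / 2)
          / (eps + beta / 2 * hstep x (S i))) + K2 * beta) ->
  forall i, (i <= N)%nat -> Rabs (e i) <= K1 + 2 * K2.
Proof.
intros He Hb Hd HK1 HK2 Hx0 Hx Hh Hbc He0 HeN HL i Hi.
set (k := beta / (2 * eps)) in *. set (s := decay_product k x) in *.
assert (Pk : 0 < k) by (unfold k; apply Rdiv_lt_0_compat; lra).
assert (Hs : forall j, (j <= N)%nat -> 0 < s j <= 1).
{ intros j Hj. destruct (decay_product_bounds k x N Pk Hx0 Hh j Hj) as [H1 H2].
  pose proof (layer_pos (2 * k) (x j)). fold s in H1, H2. lra. }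
(* The sign [r] treats the upper and lower bounds together. *)
assert (key : forall r, r = 1 \/ r = -1 -> r * e i <= K1 + 2 * K2).
{ intros r Hr.
  assert (HV : r * e i + (- K1) * s i + (- K2) * (-1 * x i + 2) <= 0).
  { apply (discrete_maximum_principle eps b c x
      (fun j => r * e j + (- K1) * s j + (- K2) * (-1 * x j + 2)) N); auto.
    - intros j Hj; destruct (Hbc j Hj); lra.
    - rewrite He0, Hx0. specialize (Hs 0%nat ltac:(lia)). nra.
    - rewrite HeN. specialize (Hs N ltac:(lia)). specialize (Hx N ltac:(lia)). nra.
    - intros j Hj. rewrite (LN_linear eps b c x e s (fun j => -1 * x j + 2)).
      destruct (Hbc j Hj) as [Bj Cj]. specialize (HL j Hj). specialize (Hx j ltac:(lia)).
      assert (Hj1 := Hh j ltac:(lia)). assert (Hj2 := Hh (S j) ltac:(lia)).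
      rewrite LN_affine by assumption.
      destruct (Hs j ltac:(lia)) as [Sj _].
      assert (LS := LN_decay_product eps beta delta b c x j He Hb Hd ltac:(lia) Bj Cj
        Hj1 Hj2 Sj). fold k s in LS.
      apply (Rmult_le_compat_l K1) in LS; [|assumption].
      assert (0 <= c (x j) * (-1 * x j + 2)) by (apply Rmult_le_pos; lra).
      assert (r * LN eps b c x e j <= Rabs (LN eps b c x e j)).
      { destruct Hr as [-> | ->]; unfold Rabs; destruct Rcase_abs; lra. }
      assert (K2 * beta < K2 * (- b (x j) * -1 + c (x j) * (-1 * x j + 2))).
      { apply Rmult_lt_compat_l; lra. }
      lra. }
  specialize (Hs i Hi). specialize (Hx i Hi). nra. }
apply Rabs_le_between; split.
- specialize (key (-1) ltac:(auto)); lra.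
- specialize (key 1 ltac:(auto)); lra.
Qed.

Lemma mesh_range (eps beta a lambda : R) (N J : nat) :
  (0 < J < N)%nat -> 0 < xi_tr eps beta a lambda < 1 ->
  let x := meshpt eps beta a lambda N J in
  x 0%nat = 0 /\ x J = xi_tr eps beta a lambda /\ x N = 1 /\
  (forall i, (1 <= i <= N)%nat -> 0 < hstep x i) /\
  (forall i, (i <= N)%nat -> 0 <= x i <= 1) /\
  (forall i, (1 <= i <= N - 1)%nat -> 0 < x i < 1).
Proof.
intros HJ Hxi x. set (xi := xi_tr eps beta a lambda) in *.
assert (PJ : 0 < INR J) by (apply lt_0_INR; lia).
assert (PN : 0 < INR (N - J)) by (apply lt_0_INR; lia).
assert (Hh : forall i, (1 <= i <= N)%nat -> 0 < hstep x i).
{ intros i Hi. unfold x. destruct (Nat.le_gt_cases i J).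
  - rewrite hstep_fine by lia. apply Rdiv_lt_0_compat; fold xi; lra.
  - rewrite hstep_coarse by lia. apply Rdiv_lt_0_compat; fold xi; lra. }
assert (X0 : x 0%nat = 0) by (unfold x; rewrite mesh_fine by lia; simpl; ring).
assert (XN : x N = 1).
{ unfold x; rewrite mesh_coarse by lia. fold xi. field. lra. }
assert (mono : forall n i, (i + n <= N)%nat -> x i <= x (i + n)%nat /\
  ((0 < n)%nat -> x i < x (i + n)%nat)).
{ induction n as [|n IH]; intros i Hi.
  - rewrite Nat.add_0_r; split; [lra|lia].
  - specialize (IH i ltac:(lia)). specialize (Hh (S (i + n)) ltac:(lia)).
    unfold hstep in Hh. replace (S (i + n) - 1)%nat with (i + n)%nat in Hh by lia.
    replace (i + S n)%nat with (S (i + n)) by lia.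
    split; intros; lra. }
repeat split; auto.
- unfold x; rewrite mesh_fine by lia. fold xi. field. lra.
- rewrite <- X0. apply (mono i 0%nat). lia.
- rewrite <- XN. replace N with (i + (N - i))%nat at 1 by lia. apply mono; lia.
- rewrite <- X0. apply (mono i 0%nat); lia.
- rewrite <- XN. replace N with (i + (N - i))%nat at 1 by lia. apply mono; lia.
Qed.

(** * Error estimate for the layer component *)

(** Collects the quantities that the final rate [m] must dominate. The first uses [L^2 <= 1 + L^3]
    and so both members of the maximum; the last uses [n < L <= L^3]. *)
Lemma rate_bounds (eps L n : R) :
  0 < eps < 1 -> 0 < L -> 1 <= n ->
  let m := Rmax (eps * L ^ 3 * / n ^ 2) (eps * / n ^ 2 + eps ^ 2 * / n) in
  eps * (L / n) ^ 2 <= 2 * m /\ eps * (L / n) ^ 3 <= m /\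
  eps / n ^ 2 <= m /\ eps ^ 2 / n <= m /\ (n < L -> eps / n <= m).
Proof.
intros He HL Hn m.
set (A := eps * L ^ 3 * / n ^ 2) in *. set (B := eps * / n ^ 2 + eps ^ 2 * / n) in *.
assert (HA : A <= m) by apply Rmax_l. assert (HB : B <= m) by apply Rmax_r.
assert (Pn2 : 0 < / n ^ 2) by (apply Rinv_0_lt_compat, pow_lt; lra).
assert (Pn : 0 < / n) by (apply Rinv_0_lt_compat; lra).
assert (Pe2 : 0 < eps ^ 2 * / n) by (apply Rmult_lt_0_compat; [apply pow_lt|]; lra).
assert (Pe1 : 0 < eps * / n ^ 2) by (apply Rmult_lt_0_compat; lra).
assert (PL3 : 0 < L ^ 3) by (apply pow_lt; lra).
assert (PA : 0 < A) by (unfold A; repeat apply Rmult_lt_0_compat; lra).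
repeat split; [| | unfold Rdiv, B in *; lra | unfold Rdiv, B in *; lra |].
- apply Rle_trans with (A + B); [|lra].
  replace (eps * (L / n) ^ 2) with (eps * / n ^ 2 * L ^ 2) by (field; lra).
  apply Rle_trans with (eps * / n ^ 2 * (1 + L ^ 3)); [|unfold A, B; lra].
  apply Rmult_le_compat_l; [lra|].
  destruct (Rle_dec L 1); nra.
- apply Rle_trans with A; [|assumption].
  replace (eps * (L / n) ^ 3) with (A * / n) by (unfold A; field; lra).
  rewrite <- (Rmult_1_r A) at 2. apply Rmult_le_compat_l; [lra|].
  rewrite <- Rinv_1. apply Rinv_le_contravar; lra.
- intros HnL. apply Rle_trans with A; [|assumption].
  unfold A. replace (eps / n) with (eps * n * / n ^ 2) by (field; lra).
  apply Rmult_le_compat_r; [lra|]. apply Rmult_le_compat_l; [lra|].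
  assert (1 <= L ^ 2) by nra. nra.
Qed.

Lemma pow_exp_opp (L : R) (k : nat) : exp (- L) ^ k = exp (- (INR k * L)).
Proof.
rewrite <- Rpower_pow by apply exp_pos. unfold Rpower. rewrite ln_exp. f_equal; ring.
Qed.

(** The exponential is the layer one fine step before the transition point. For [j >= 4] the
    exponent keeps three quarters of [a >= 4]; if [L <= n], the step costs only the constant
    [exp (a / Q)]. *)
Lemma transition_layer_bound (eps L a Q n j : R) :
  0 < eps -> eps = exp (- L) -> 0 < L -> 4 <= a -> 0 < Q -> 4 <= j -> j = Q * n ->
  exp (- (a * L) * (1 - / j)) <= eps ^ 3 /\
  (L <= n -> exp (- (a * L) * (1 - / j)) <= eps ^ 4 * exp (a / Q)).
Proof.
intros He Ee HL Ha HQ Hj Ej.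
assert (mono : forall u v, u <= v -> exp u <= exp v).
{ intros u v [H| ->]; [left; now apply exp_increasing|lra]. }
assert (Ep : forall k : nat, eps ^ k = exp (- (INR k * L))).
{ intros k; rewrite Ee; apply pow_exp_opp. }
assert (Ij : 0 < / j <= / 4).
{ split; [apply Rinv_0_lt_compat; lra|apply Rinv_le_contravar; lra]. }
split.
- rewrite Ep. apply mono. simpl.
  assert (4 * L * (3 / 4) <= a * L * (1 - / j)).
  { apply Rmult_le_compat; try nra. }
  lra.
- intros HLn. rewrite Ep, <- exp_plus. apply mono. simpl.
  assert (a * L * / j <= a / Q).
  { rewrite Ej. apply Rle_trans with (a * n * / (Q * n)).
    - apply Rmult_le_compat_r; [rewrite <- Ej; lra|]. nra.
    - right; field. split; nra. }
  nra.
Qed.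

Lemma ln_neg (x : R) : 0 < x < 1 -> ln x < 0.
Proof. intros H; rewrite <- ln_1; apply ln_increasing; lra. Qed.

Lemma locally_01 (x : R) : 0 < x < 1 -> locally x (fun y => 0 < y < 1).
Proof.
intros Hx. apply (open_and (fun y => 0 < y) (fun y => y < 1));
  [apply open_gt|apply open_lt|lra].
Qed.

Lemma layer_error (beta delta K W a Q : R) :
  0 < beta -> 0 < delta -> 0 < K -> 0 < W -> 4 <= a -> 0 < Q < 1 ->
  exists (N0 : nat) (C : R),
  forall (eps : R) (b b1 b2 c c1 c2 w w1 w2 : R -> R) (N J : nat) (V : nat -> R),
  0 < eps < 1 ->
  (forall x, 0 < x < 1 -> beta + delta <= b x) ->
  (forall x, 0 < x < 1 -> 0 <= c x) ->
  C2_bounded K b b1 b2 -> C2_bounded K c c1 c2 ->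
  homogeneous_solution eps b c w w1 w2 ->
  Rabs (w 0) <= W -> w 1 = 0 ->
  (0 < N)%nat -> (N0 <= N)%nat -> Q * INR N = INR J ->
  xi_tr eps beta a (/ eps) <= Q ->
  V 0%nat = w 0 -> V N = 0 ->
  (forall i, (1 <= i <= N - 1)%nat ->
     LN eps b c (meshpt eps beta a (/ eps) N J) V i = 0) ->
  forall i, (i <= N)%nat ->
    Rabs (w (meshpt eps beta a (/ eps) N J i) - V i)
      <= C * Rmax (eps * Rabs (ln eps) ^ 3 * / (INR N ^ 2))
                  (eps * / (INR N ^ 2) + eps ^ 2 * / INR N).
Proof.
intros Hbeta Hdelta HK HW Ha HQ.
destruct (layer_derivative_bounds beta K W Hbeta HK HW) as [M [HM Hdecay]].
(* [N0 > 4 / Q] ensures [J > 4], as [transition_layer_bound] requires. *)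
destruct (INR_unbounded (4 / Q)) as [N0 HN0].
set (C1 := 5 * K * M + 3 * K ^ 2 * M + 5 * K ^ 2 * M / delta).
assert (PKM : 0 < K * M) by (apply Rmult_lt_0_compat; lra).
assert (PK2M : 0 < K ^ 2 * M) by (apply Rmult_lt_0_compat; [apply pow_lt|]; lra).
assert (PC1 : 0 < C1).
{ assert (0 < 5 * K ^ 2 * M / delta) by (apply Rdiv_lt_0_compat; lra). unfold C1; lra. }
(* [g] is the constant in [h / eps = g * (L / n)]. *)
set (g := a / (beta * Q)).
assert (PbQ : 0 < beta * Q) by (apply Rmult_lt_0_compat; lra).
assert (Pg : 0 < g) by (apply Rdiv_lt_0_compat; lra).
assert (Pbd : 0 < beta * delta) by (apply Rmult_lt_0_compat; lra).
set (G := 2 * C1 * g ^ 2 / (beta * delta)).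
assert (PG : 0 < G).
{ apply Rdiv_lt_0_compat; [|assumption].
  apply Rmult_lt_0_compat; [lra|now apply pow_lt]. }
set (D := / (1 - Q)). assert (PD : 0 < D) by (apply Rinv_0_lt_compat; lra).
set (E := exp (a / Q)). assert (PE : 0 < E) by apply exp_pos.
set (A1 := G * (2 + beta / 2 * g)).
set (A2 := (C1 * D ^ 2 + 6 * (K * M) * (D * (E + 1))) / beta).
exists N0, (A1 + 2 * A2).
intros eps b b1 b2 c c1 c2 w w1 w2 N J V He Bb Bc HB HC Hhom HW0 HW1 HN HNN HJ Hxi V0 VN HL.
assert (Hdec : decays_like_layer M eps (beta / eps) w w1 w2).
{ apply (Hdecay eps b b1 b2 c w w1 w2); auto.
  - intros x Hx; specialize (Bb x Hx); lra.
  - intros x Hx; specialize (Bc x Hx).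
    destruct (HC x Hx) as [_ [_ [H _]]]. rewrite Rabs_right in H; lra. }
set (L := - ln eps).
assert (PL : 0 < L) by (unfold L; pose proof (ln_neg eps He); lra).
assert (Ee : eps = exp (- L)) by (unfold L; rewrite Ropp_involutive, exp_ln; lra).
assert (Exi : xi_tr eps beta a (/ eps) = a * eps / beta * L).
{ unfold xi_tr, L. rewrite ln_Rinv by lra. reflexivity. }
replace (Rabs (ln eps)) with L
  by (unfold L; rewrite Rabs_left; [reflexivity|apply ln_neg; lra]).
set (n := INR N) in *.
assert (HNn : 4 / Q < n) by (eapply Rlt_le_trans; [exact HN0|apply le_INR; lia]).
assert (HJ4 : 4 < INR J).
{ rewrite <- HJ. apply Rlt_div_l in HNn; lra. }
assert (Hn1 : 1 <= n).
{ unfold n; change 1 with (INR 1); apply le_INR; lia. }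
assert (HJN : (0 < J < N)%nat).
{ split; apply INR_lt; [simpl; lra|]. fold n. rewrite <- HJ. nra. }
set (xi := xi_tr eps beta a (/ eps)) in *.
assert (Pxi : 0 < xi).
{ rewrite Exi. apply Rmult_lt_0_compat; [|lra]. apply Rdiv_lt_0_compat; nra. }
set (x := meshpt eps beta a (/ eps) N J) in *.
destruct (mesh_range eps beta a (/ eps) N J HJN) as [X0 [XJ [XN [Hh [X01 Xin]]]]].
{ fold xi; lra. }
fold x in X0, XJ, XN, Hh, X01, Xin. fold xi in XJ.
destruct (rate_bounds eps L n He PL Hn1) as [R2 [R3 [Rn2 [Rn Rlog]]]].
set (m := Rmax (eps * L ^ 3 * / n ^ 2) (eps * / n ^ 2 + eps ^ 2 * / n)) in *.
set (h := xi / INR J). set (H := (1 - xi) / INR (N - J)).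
assert (Ph : 0 < h) by (apply Rdiv_lt_0_compat; lra).
assert (Ehe : h / eps = g * (L / n)).
{ unfold h, g. rewrite Exi, <- HJ. field. repeat split; lra. }
assert (ENJ : INR (N - J) = (1 - Q) * n).
{ rewrite minus_INR by lia. fold n. lra. }
assert (PNJ : 0 < (1 - Q) * n) by (apply Rmult_lt_0_compat; lra).
assert (PH : 0 < H) by (apply Rdiv_lt_0_compat; rewrite ?ENJ; lra).
assert (HD : H <= D * / n).
{ unfold H, D. rewrite ENJ, <- Rinv_mult. rewrite <- (Rmult_1_l (/ _)).
  apply Rmult_le_compat_r; [left; now apply Rinv_0_lt_compat|lra]. }
(* [xi <= Q] puts [1 / n] between the two step sizes. *)
assert (HhH : h <= H).
{ apply Rle_trans with (/ n).
  - unfold h. apply Rle_div_l; [lra|]. rewrite <- HJ.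
    replace (/ n * (Q * n)) with Q by (field; lra). assumption.
  - unfold H. rewrite ENJ. apply Rle_div_r; [assumption|].
    replace (/ n * ((1 - Q) * n)) with (1 - Q) by (field; lra). lra. }
set (k := beta / eps) in *.
assert (Pk : 0 < k) by (apply Rdiv_lt_0_compat; lra).
set (P := layer k (xi - h)). assert (PP : 0 < P) by apply layer_pos.
assert (Pe2 : 0 < eps ^ 2) by (apply pow_lt; lra).
assert (EP : P = exp (- (a * L) * (1 - / INR J))).
{ unfold P, layer, k, h. rewrite Exi. f_equal. field. lra. }
destruct (transition_layer_bound eps L a Q n (INR J)) as [TP1 TP2]; try lra; auto.
rewrite <- EP in TP1, TP2.
assert (Elay : layer k xi <= eps ^ 4).
{ replace (eps ^ 4) with (exp (- (INR 4 * L))) by (rewrite Ee; symmetry; apply pow_exp_opp).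
  unfold layer. simpl INR.
  assert (k * xi = a * L) by (unfold k; rewrite Exi; field; lra).
  destruct (Req_dec a 4) as [->|]; [right; f_equal; lra|].
  left; apply exp_increasing. nra. }
(* The last two factors undo the constants in [LN_decay_product], so [K1] times that lower bound is
   [C1 * (h / eps)^2 * s] on the fine part. *)
set (K1 := C1 * (h / eps) ^ 2 * (eps + beta / 2 * h) * (2 / (beta * delta))).
(* The first summand bounds the coarse part, where the layer is at most [eps^4], and the second the
   transition point; division by [beta] matches the barrier [2 - x]. *)
set (K2 := (C1 * (H / eps) ^ 2 * eps ^ 4 + 6 * (K * M) * (H / eps ^ 2 * P)) / beta).
assert (PK1 : 0 < K1).
{ unfold K1. assert (0 < beta / 2 * h) by (apply Rmult_lt_0_compat; lra).
  assert (0 < (h / eps) ^ 2) by (apply pow_lt, Rdiv_lt_0_compat; lra).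
  apply Rmult_lt_0_compat; [|apply Rdiv_lt_0_compat; lra].
  apply Rmult_lt_0_compat; [now apply Rmult_lt_0_compat|lra]. }
assert (PT1 : 0 < C1 * (H / eps) ^ 2 * eps ^ 4).
{ apply Rmult_lt_0_compat; [|apply pow_lt; lra].
  apply Rmult_lt_0_compat; [lra|]. apply pow_lt, Rdiv_lt_0_compat; lra. }
assert (PT2 : 0 < 6 * (K * M) * (H / eps ^ 2 * P)).
{ apply Rmult_lt_0_compat; [lra|]. apply Rmult_lt_0_compat; [|assumption].
  apply Rdiv_lt_0_compat; lra. }
assert (PK2 : 0 < K2) by (unfold K2; apply Rdiv_lt_0_compat; lra).
assert (EK2 : K2 * beta = C1 * (H / eps) ^ 2 * eps ^ 4 + 6 * (K * M) * (H / eps ^ 2 * P))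
  by (unfold K2; field; lra).
assert (BK1 : K1 <= A1 * m).
{ replace K1 with (G * (eps * (L / n) ^ 2 + beta / 2 * g * (eps * (L / n) ^ 3))).
  - unfold A1. rewrite (Rmult_assoc G). apply Rmult_le_compat_l; [lra|].
    assert (beta / 2 * g * (eps * (L / n) ^ 3) <= beta / 2 * g * m).
    { apply Rmult_le_compat_l; [|assumption]. left; apply Rmult_lt_0_compat; lra. }
    lra.
  - unfold K1. replace h with (eps * (h / eps)) at 2 by (field; lra). rewrite Ehe.
    unfold G. field. lra. }
assert (BK2 : K2 <= A2 * m).
{ unfold K2, A2. replace ((C1 * D ^ 2 + 6 * (K * M) * (D * (E + 1))) / beta * m)
    with ((C1 * (D ^ 2 * m) + 6 * (K * M) * (D * (E + 1) * m)) / beta) by (field; lra).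
  apply Rmult_le_compat_r; [left; apply Rinv_0_lt_compat; lra|].
  assert (Pin : 0 < / n) by (apply Rinv_0_lt_compat; lra).
  apply Rplus_le_compat.
  - rewrite (Rmult_assoc C1). apply Rmult_le_compat_l; [lra|].
    replace ((H / eps) ^ 2 * eps ^ 4) with (H ^ 2 * eps ^ 2) by (field; lra).
    apply Rle_trans with ((D * / n) ^ 2 * eps).
    + apply Rmult_le_compat; [apply pow2_ge_0|lra| |nra].
      apply pow_incr; lra.
    + replace ((D * / n) ^ 2 * eps) with (D ^ 2 * (eps / n ^ 2)) by (field; lra).
      apply Rmult_le_compat_l; [apply pow2_ge_0|assumption].
  - apply Rmult_le_compat_l; [lra|].
    apply Rle_trans with (D * / n * (P / eps ^ 2)).
    { replace (H / eps ^ 2 * P) with (H * (P / eps ^ 2)) by (field; lra).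
      apply Rmult_le_compat_r; [|assumption]. left; apply Rdiv_lt_0_compat; lra. }
    assert (Pm : 0 < m).
    { eapply Rlt_le_trans; [|exact Rn]. apply Rdiv_lt_0_compat; lra. }
    assert (PDm : 0 < D * m) by (apply Rmult_lt_0_compat; assumption).
    assert (PDEm : 0 < D * m * E) by (apply Rmult_lt_0_compat; assumption).
    (* If [L <= n], then [P <= eps^4 E] gives [eps^2 / n]. Otherwise [P <= eps^3] gives only
       [eps / n], which the logarithmic member of the maximum covers. *)
    destruct (Rle_or_lt L n) as [HLn|HLn].
    + specialize (TP2 HLn). fold E in TP2.
      apply Rle_trans with (D * / n * (eps ^ 2 * E)).
      * apply Rmult_le_compat_l; [left; apply Rmult_lt_0_compat; lra|].
        apply Rle_div_l; [assumption|].
        replace (eps ^ 2 * E * eps ^ 2) with (eps ^ 4 * E) by ring. assumption.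
      * replace (D * / n * (eps ^ 2 * E)) with (D * E * (eps ^ 2 / n)) by (field; lra).
        apply Rle_trans with (D * E * m); [|lra].
        apply Rmult_le_compat_l; [left; now apply Rmult_lt_0_compat|assumption].
    + specialize (Rlog HLn).
      apply Rle_trans with (D * / n * eps).
      * apply Rmult_le_compat_l; [left; apply Rmult_lt_0_compat; lra|].
        apply Rle_div_l; [assumption|].
        replace (eps * eps ^ 2) with (eps ^ 3) by ring. assumption.
      * replace (D * / n * eps) with (D * (eps / n)) by (field; lra).
        apply Rle_trans with (D * m); [|lra].
        apply Rmult_le_compat_l; lra. }
intros i Hi.
apply Rle_trans with (K1 + 2 * K2); [|lra].
apply (barrier_comparison eps beta delta K1 K2 b c x (fun j => w (x j) - V j) N);
  auto; try lra.
{ rewrite X0; lra. }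
{ rewrite XN, HW1; lra. }
clear i Hi. intros i Hi.
assert (Hxi01 := Xin i Hi). assert (Bi := Bb _ Hxi01). assert (Ci := Bc _ Hxi01).
replace (LN eps b c x (fun j => w (x j) - V j) i)
  with (stencil eps (b (x i)) (hstep x i) (hstep x (S i)) w (x i) + c (x i) * w (x i)).
2:{ rewrite <- LN_stencil. specialize (HL i Hi).
  transitivity (LN eps b c x (fun j => w (x j)) i - LN eps b c x V i); [lra|].
  unfold LN, Defs.D2, Dplus, Defs.Dminus, Rdiv; ring. }
assert (Xm : x (i - 1)%nat = x i - hstep x i) by (unfold hstep; ring).
assert (Xp : x (S i) = x i + hstep x (S i))
  by (unfold hstep; simpl Nat.sub; rewrite Nat.sub_0_r; ring).
assert (Xm0 := X01 (i - 1)%nat ltac:(lia)). assert (Xp1 := X01 (S i) ltac:(lia)).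
rewrite Xm in Xm0. rewrite Xp in Xp1.
pose proof (layer_pos k (x i)) as Pl.
assert (PS : layer k (x i) <= decay_product (beta / (2 * eps)) x i).
{ replace k with (2 * (beta / (2 * eps))) by (unfold k; field; lra).
  apply (decay_product_bounds (beta / (2 * eps)) x N); auto; try lia.
  apply Rdiv_lt_0_compat; lra. }
set (s := decay_product (beta / (2 * eps)) x i) in *.
assert (Pfrac : forall t, 0 < t -> 0 < s * (beta * delta / 2) / (eps + beta / 2 * t)).
{ intros t Ht. assert (0 < beta / 2 * t) by (apply Rmult_lt_0_compat; lra).
  apply Rdiv_lt_0_compat; [|lra]. apply Rmult_lt_0_compat; lra. }
assert (PhS := Hh (S i) ltac:(lia)).
assert (PhS' := Rmult_lt_0_compat _ _ PK1 (Pfrac _ PhS)).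
(* Fine nodes use the [K1] term, the transition point and coarse nodes the [K2] term; the other term
   is merely positive. *)
destruct (Nat.lt_trichotomy i J) as [Hij|[Hij|Hij]].
- assert (E1 : hstep x i = h) by (apply hstep_fine; lia).
  assert (E2 : hstep x (S i) = h) by (apply hstep_fine; lia).
  rewrite E1, E2 in *.
  eapply Rle_trans; [apply (truncation_uniform eps beta delta K M h (x i)
    b b1 b2 c c1 c2 w w1 w2); auto; lra|].
  fold C1 k.
  replace (K1 * (s * (beta * delta / 2) / (eps + beta / 2 * h)))
    with (C1 * ((h / eps) ^ 2 * s)).
  2:{ unfold K1. field. assert (0 < beta * h) by (apply Rmult_lt_0_compat; lra).
      repeat split; lra. }
  assert (C1 * ((h / eps) ^ 2 * layer k (x i)) <= C1 * ((h / eps) ^ 2 * s)).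
  { apply Rmult_le_compat_l; [lra|]. apply Rmult_le_compat_l; [apply pow2_ge_0|assumption]. }
  lra.
- subst i.
  assert (E1 : hstep x J = h) by (apply hstep_fine; lia).
  assert (E2 : hstep x (S J) = H) by (apply hstep_coarse; lia).
  rewrite E1, E2, XJ in *.
  eapply Rle_trans; [apply (truncation_nonuniform eps k K M h H xi
    b b1 b2 c c1 c2 w w1 w2); auto; lra|].
  fold P. lra.
- assert (E1 : hstep x i = H) by (apply hstep_coarse; lia).
  assert (E2 : hstep x (S i) = H) by (apply hstep_coarse; lia).
  rewrite E1, E2 in *.
  eapply Rle_trans; [apply (truncation_uniform eps beta delta K M H (x i)
    b b1 b2 c c1 c2 w w1 w2); auto; lra|].
  fold C1 k.
  assert (Hle : layer k (x i) <= eps ^ 4).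
  { eapply Rle_trans; [|exact Elay]. apply layer_antitone; [assumption|].
    unfold x; rewrite mesh_coarse by lia. fold xi. fold H.
    assert (0 <= INR (i - J) * H) by (apply Rmult_le_pos; [apply pos_INR|lra]). lra. }
  assert (C1 * ((H / eps) ^ 2 * layer k (x i)) <= C1 * (H / eps) ^ 2 * eps ^ 4).
  { rewrite <- Rmult_assoc. apply Rmult_le_compat_l; [|assumption].
    apply Rmult_le_pos; [lra|apply pow2_ge_0]. }
  lra.
Qed.

(** * Regularity of the data and reduction to the layer component *)

Lemma continuous_bounded_01 (g : R -> R) :
  (forall x, 0 <= x <= 1 -> continuity_pt g x) ->
  exists B, forall x, 0 <= x <= 1 -> Rabs (g x) <= B.
Proof.
intros H.
destruct (continuity_ab_maj (fun x => Rabs (g x)) 0 1) as [m [Hm _]]; [lra| |].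
- intros x Hx. apply (continuity_pt_comp g Rabs); [auto|apply Rcontinuity_abs].
- eauto.
Qed.

(** Compactness of [[0,1]] gives both the bounds and the uniform gap [d]; the gap for [b] above
    [beta] becomes [delta]. *)
Lemma C4_01_C2_bounded (g : R -> R) :
  C4_01 g ->
  (exists g1 g2 B, 0 < B /\ C2_bounded B g g1 g2) /\
  (forall l, (forall x, 0 <= x <= 1 -> l < g x) ->
     exists d, 0 < d /\ forall x, 0 <= x <= 1 -> l + d <= g x).
Proof.
intros [G [HG [Hd _]]].
assert (D : forall n x, (n <= 3)%nat -> is_derive (Derive_n G n) x (Derive_n G (S n) x)).
{ intros n x Hn. apply Derive_correct. apply (Hd (S n) x). lia. }
assert (Cn : forall n x, (n <= 3)%nat -> continuity_pt (Derive_n G n) x).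
{ intros n x Hn; eapply is_derive_continuity, D, Hn. }
split.
- exists (Derive_n G 1), (Derive_n G 2).
  destruct (continuous_bounded_01 (Derive_n G 0)) as [B0 H0]; [auto with arith|].
  destruct (continuous_bounded_01 (Derive_n G 1)) as [B1 H1]; [auto with arith|].
  destruct (continuous_bounded_01 (Derive_n G 2)) as [B2 H2]; [auto with arith|].
  exists (1 + Rabs B0 + Rabs B1 + Rabs B2).
  pose proof (Rle_abs B0); pose proof (Rle_abs B1); pose proof (Rle_abs B2).
  pose proof (Rabs_pos B0); pose proof (Rabs_pos B1); pose proof (Rabs_pos B2).
  split; [lra|]. intros x Hx.
  specialize (H0 x ltac:(lra)); specialize (H1 x ltac:(lra)); specialize (H2 x ltac:(lra)).
  simpl Derive_n in H0 at 1. rewrite HG in H0 by lra.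
  split; [|split; [apply (D 1%nat); lia|repeat split; lra]].
  (* [g] may differ from [G] outside [[0,1]], so the derivative is transferred only near interior
     points. *)
  apply (is_derive_ext_loc G); [|apply (D 0%nat); lia].
  apply filter_imp with (2 := locally_01 x Hx). intros; apply HG; lra.
- intros l Hl.
  destruct (continuity_ab_min G 0 1) as [m [Hm Im]]; [lra|intros; apply (Cn 0%nat); lia|].
  exists (g m - l); split; [specialize (Hl m Im); lra|].
  intros x Hx. specialize (Hm x Hx). rewrite !HG in Hm by assumption. lra.
Qed.

(** The nearest-point retraction onto [[0,1]]; being 1-Lipschitz, it turns continuity relative to
    [[0,1]] into two-sided continuity. *)
Definition clamp (x : R) : R := Rmax 0 (Rmin x 1).

Lemma clamp_id (x : R) : 0 <= x <= 1 -> clamp x = x.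
Proof. intros H; unfold clamp; rewrite Rmin_left, Rmax_right; lra. Qed.

Lemma clamp_range (x : R) : 0 <= clamp x <= 1.
Proof. unfold clamp, Rmax, Rmin; repeat destruct Rle_dec; lra. Qed.

Lemma clamp_continuity (u : R -> R) (x : R) :
  cont_01 u -> continuity_pt (fun y => u (clamp y)) x.
Proof.
intros Hu. apply continuity_pt_filterlim.
intros A HA. destruct (Hu (clamp x) (clamp_range x) A HA) as [d Hd].
exists d. intros y Hy. apply Hd; [|apply clamp_range].
change (Rabs (y - x) < d) in Hy. change (Rabs (clamp y - clamp x) < d).
eapply Rle_lt_trans; [|exact Hy].
unfold clamp, Rmax, Rmin; repeat destruct Rle_dec; unfold Rabs;
  repeat destruct Rcase_abs; lra.
Qed.

Lemma layer_component (eps al ga : R) (b c f u : R -> R) :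
  (forall x, 0 < x < 1 -> - b x * al + c x * (al * x + ga) = f x) ->
  is_solution eps b c f u ->
  homogeneous_solution eps b c (fun x => u (clamp x) - (al * x + ga))
    (fun x => Derive u x - al) (Derive (Derive u)).
Proof.
intros Hf [Hu [Hd _]].
assert (Ext : forall x, 0 < x < 1 -> locally x (fun y => u y = u (clamp y))).
{ intros x Hx. apply filter_imp with (2 := locally_01 x Hx).
  intros y Hy. rewrite clamp_id; lra. }
split; [|split]; intros x Hx.
- apply continuity_pt_minus; [now apply clamp_continuity|].
  eapply is_derive_continuity; auto_derive; trivial.
- destruct (Hd x Hx) as [D1 [D2 _]]. split.
  + apply (@is_derive_minus R_AbsRing R_NormedModule).
    * eapply is_derive_ext_loc; [now apply Ext|now apply Derive_correct].
    * auto_derive; [trivial|ring].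
  + replace (Derive (Derive u) x) with (Derive (Derive u) x - 0) by ring.
    apply (@is_derive_minus R_AbsRing R_NormedModule); [now apply Derive_correct|].
    apply (@is_derive_const R_AbsRing R_NormedModule).
- destruct (Hd x Hx) as [_ [_ HL]]. rewrite clamp_id by lra.
  specialize (Hf x Hx). lra.
Qed.

(** The reduced equation then expresses [f] through [b], [c] and the line, a formula shared by the
    differential operator and the scheme. *)
Lemma reduced_linear (b c f u0 : R -> R) (al ga : R) :
  is_reduced_solution b c f u0 ->
  (forall x, 0 <= x <= 1 -> u0 x = al * x + ga) ->
  al + ga = 0 /\
  forall x, 0 < x < 1 -> - b x * al + c x * (al * x + ga) = f x.
Proof.
intros [_ [Hd H1]] Hl. split; [rewrite Hl in H1; lra|].
intros x Hx. destruct (Hd x Hx) as [_ E].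
rewrite Hl in E by lra. rewrite <- E. do 2 f_equal.
symmetry. apply is_derive_unique.
apply (is_derive_ext_loc (fun y => al * y + ga)); [|auto_derive; [trivial|ring]].
apply filter_imp with (2 := locally_01 x Hx). intros y Hy. rewrite Hl; lra.
Qed.

Theorem theorem7 :
  forall (b c f : R -> R) (beta : R),
    C4_01 b -> C4_01 c -> C4_01 f ->
    0 < beta ->
    (forall x, 0 <= x <= 1 -> b x > beta) ->
    (forall x, 0 <= x <= 1 -> c x >= 0) ->
  forall u0 : R -> R,
    is_reduced_solution b c f u0 -> is_linear_01 u0 ->
  forall (a Q : R),
    4 <= a ->
    0 < Q < 1 -> is_rational Q ->
  exists (N0 : nat) (C : R),
  forall (eps : R), 0 < eps < 1 ->
  forall (N J : nat),
    (0 < N)%nat -> (N0 <= N)%nat ->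
    Q * INR N = INR J ->
    xi_tr eps beta a (/ eps) <= Q ->
  forall u : R -> R, is_solution eps b c f u ->
  forall U : nat -> R,
    is_discrete_solution eps b c f (meshpt eps beta a (/ eps) N J) N U ->
  forall i : nat, (i <= N)%nat ->
    Rabs (u (meshpt eps beta a (/ eps) N J i) - U i)
      <= C * Rmax (eps * Rabs (ln eps) ^ 3 * / (INR N ^ 2))
                  (eps * / (INR N ^ 2) + eps ^ 2 * / INR N).
Proof.
intros b c f beta Hb Hc _ Hbeta Bb Bc u0 Hu0 [al [ga Hl]] a Q Ha HQ _.
destruct (reduced_linear b c f u0 al ga Hu0 Hl) as [Hag Hf].
destruct (C4_01_C2_bounded b Hb) as [[b1 [b2 [Kb [PKb HB]]]] Hmin].
destruct (C4_01_C2_bounded c Hc) as [[c1 [c2 [Kc [PKc HC]]]] _].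
destruct (Hmin beta Bb) as [delta [Hdelta Bbd]].
assert (weaken : forall B B' g g1 g2, B <= B' -> C2_bounded B g g1 g2 ->
  C2_bounded B' g g1 g2).
{ intros B B' g g1 g2 HBB H x Hx. destruct (H x Hx) as [? [? [? [? ?]]]].
  split; [|split; [|repeat split; lra]]; assumption. }
apply (weaken _ (Kb + Kc)) in HB; [|lra]. apply (weaken _ (Kb + Kc)) in HC; [|lra].
(* The layer component equals [- ga] at 0; adding 1 keeps the bound positive when [ga = 0]. *)
destruct (layer_error beta delta (Kb + Kc) (Rabs ga + 1) a Q) as [N0 [C HE]]; try lra.
{ pose proof (Rabs_pos ga); lra. }
exists N0, C.
intros eps He N J HN HNN HJ Hxi u Hu U [U0 [UN HU]] i Hi.
set (x := meshpt eps beta a (/ eps) N J) in *.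
assert (Hu' := Hu). destruct Hu' as [_ [_ [u00 u11]]].
assert (HJN : (0 < J < N)%nat).
{ assert (P : 0 < INR N) by (apply lt_0_INR; lia).
  split; apply INR_lt; [simpl INR; rewrite <- HJ; nra|nra]. }
destruct (mesh_range eps beta a (/ eps) N J HJN) as [X0 [_ [XN [Hh [X01 Xin]]]]].
{ split; [|lra]. unfold xi_tr. rewrite ln_Rinv by lra.
  pose proof (ln_neg eps He).
  apply Rmult_lt_0_compat; [|lra]. apply Rdiv_lt_0_compat; nra. }
fold x in X0, XN, Hh, X01, Xin.
assert (E := HE eps b b1 b2 c c1 c2 (fun y => u (clamp y) - (al * y + ga))
  (fun y => Derive u y - al) (Derive (Derive u)) N J
  (fun j => U j - (al * x j + ga)) He).
fold x in E. cbv beta in E.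
replace (u (x i) - U i)
  with (u (clamp (x i)) - (al * x i + ga) - (U i - (al * x i + ga)))
  by (rewrite clamp_id by (now apply X01); ring).
apply E; auto.
- intros y Hy; apply Bbd; lra.
- intros y Hy; apply Rge_le, Bc; lra.
- now apply layer_component with f.
- rewrite clamp_id, u00 by lra.
  replace (0 - (al * 0 + ga)) with (- ga) by ring. rewrite Rabs_Ropp; lra.
- rewrite clamp_id, u11 by lra. lra.
- rewrite clamp_id, u00, X0, U0 by lra. ring.
- rewrite UN, XN. lra.
- intros j Hj. specialize (HU j Hj).
  (* The scheme reproduces [f] on the line, so [U] minus the line solves the homogeneous scheme. *)
  assert (LA := LN_affine eps b c x al ga j (Hh j ltac:(lia)) (Hh (S j) ltac:(lia))).
  rewrite (Hf (x j) (Xin j Hj)) in LA.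
  transitivity (LN eps b c x U j - LN eps b c x (fun j => al * x j + ga) j).
  + unfold LN, Defs.D2, Dplus, Defs.Dminus, Rdiv; ring.
  + rewrite HU, LA; ring.
Qed.
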